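(* Let $K$ be an algebraically closed field of characteristic $p>0$, let $l>18$, let $G=\mathrm{SL}_{l+1}(K)$ and let $V=K^{l+1}$ be its natural module. Let $\pi: V\otimes \Lambda^2V\to\Lambda^3V$ be the canonical map, $\pi(v\otimes (u\wedge w))=v\wedge u\wedge w$. If $p\neq 3$, then $L(\lambda_1+\lambda_2)\cong\mathrm{Ker}(\pi)$ as $KG$-modules. If $p=3$, then $\Lambda^3V$, regarded as a submodule of $V\otimes\Lambda^2V$ via $$v_1\wedge v_2\wedge v_3\mapsto v_1\otimes(v_2\wedge v_3)-v_2\otimes(v_1\wedge v_3)+v_3\otimes(v_1\wedge v_2),$$ is contained in $\mathrm{Ker}(\pi)$, and $L(\lambda_1+\lambda_2)\cong\mathrm{Ker}(\pi)/\Lambda^3V$.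
   Context: Fix a maximal torus and a Borel subgroup of $G$; $\lambda_1,\dots,\lambda_l$ are the corresponding fundamental dominant weights of type $A_l$ in the standard ordering, with $\lambda_1$ the highest weight of $V$. $L(\lambda)$ is the irreducible rational $KG$-module with highest weight $\lambda$. *)

(* Defs.v *)
From HB Require Import structures.
From mathcomp Require Import all_boot all_order all_fingroup all_algebra.
From mathcomp Require Import mpoly generic_quotient ring_quotient.

Set Implicit Arguments.
Unset Strict Implicit.
Unset Printing Implicit Defensive.

Import GRing.Theory.
Import VectorInternalTheory.
Local Open Scope ring_scope.

Section ExteriorPower.
Variable K : fieldType.
Implicit Types W U : vectType K.

Definition vbase W (i : 'I_(dim W)) : W := r2v (delta_mx 0 i).

Lemma vbase_sum W (w : W) : w = \sum_i v2r w 0 i *: vbase i.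
Proof.
rewrite -{1}[w]v2rK [v2r w in LHS]row_sum_delta raddf_sum /=.
by apply: eq_bigr => i _; rewrite linearZ.
Qed.

Lemma v2r_vbase W (i j : 'I_(dim W)) : v2r (vbase i) 0 j = (i == j)%:R.
Proof. by rewrite /vbase r2vK mxE eqxx /= eq_sym. Qed.

Definition upd k (W : Type) (w : {ffun 'I_k -> W}) (i : 'I_k) (u : W) :
    {ffun 'I_k -> W} :=
  [ffun j => if j == i then u else w j].

Definition multilinear k W U (phi : {ffun 'I_k -> W} -> U) : Prop :=
  forall (w : {ffun 'I_k -> W}) i a u v,
    phi (upd w i (a *: u + v)) = a *: phi (upd w i u) + phi (upd w i v).

Definition alternating k W U (phi : {ffun 'I_k -> W} -> U) : Prop :=
  forall (w : {ffun 'I_k -> W}) i j, i != j -> w i = w j -> phi w = 0.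

Definition incr k d :=
  {f : {ffun 'I_k -> 'I_d} |
    [forall i : 'I_k, forall j : 'I_k, (i < j)%N ==> (f i < f j)%N]}.

(* The k-th exterior power of W in coordinates: the increasing maps f index   *)
(* the basis e_(f 0) /\ ... /\ e_(f (k - 1)), where e is the basis of W       *)
(* underlying v2r, and the coordinates of a decomposable vector are minors.   *)
(* ext_liftE and wedge_eq below are the universal property.                   *)
Definition ext k W : vectType K := {ffun incr k (dim W) -> K^o}.

Definition wedge k W (w : {ffun 'I_k -> W}) : ext k W :=
  [ffun f : incr k (dim W) => \det (\matrix_(i, j) v2r (w i) 0 (val f j)) : K^o].

Definition ext_lift_fun k W U (phi : {ffun 'I_k -> W} -> U) (x : ext k W) : U :=
  \sum_(f : incr k (dim W)) x f *: phi [ffun i => vbase (val f i)].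

Fact ext_lift_linear k W U (phi : {ffun 'I_k -> W} -> U) :
  linear (ext_lift_fun phi).
Proof.
move=> a x y; rewrite /ext_lift_fun scaler_sumr -big_split /=.
by apply: eq_bigr => f _; rewrite !ffunE scalerDl scalerA.
Qed.
HB.instance Definition _ k W U (phi : {ffun 'I_k -> W} -> U) :=
  GRing.isLinear.Build K (ext k W) U *:%R (ext_lift_fun phi) (ext_lift_linear phi).

Definition ext_lift k W U (phi : {ffun 'I_k -> W} -> U) : 'Hom(ext k W, U) :=
  linfun (ext_lift_fun phi).

Lemma upd_id k (W : Type) (w : {ffun 'I_k -> W}) i : upd w i (w i) = w.
Proof. by apply/ffunP => j; rewrite ffunE; case: eqP => [->|]. Qed.

Lemma updC k (W : Type) (w : {ffun 'I_k -> W}) i j u v : i != j ->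
  upd (upd w i u) j v = upd (upd w j v) i u.
Proof.
move=> ij; apply/ffunP => m; rewrite !ffunE.
by case: (m =P j) => // ->; rewrite eq_sym (negPf ij).
Qed.

Section Multi.
Variables (k : nat) (W U : vectType K) (phi : {ffun 'I_k -> W} -> U).
Hypothesis phi_lin : multilinear phi.

Lemma multi0 w i : phi (upd w i 0) = 0.
Proof.
have := phi_lin w i (-1) 0 0; rewrite scaler0 addr0 scaleN1r.
by rewrite addNr.
Qed.

Lemma multiD w i u v : phi (upd w i (u + v)) = phi (upd w i u) + phi (upd w i v).
Proof. by rewrite -[u in LHS]scale1r phi_lin scale1r. Qed.

Lemma multi_sum w i n (c : 'I_n -> K) (x : 'I_n -> W) :
  phi (upd w i (\sum_j c j *: x j)) = \sum_j c j *: phi (upd w i (x j)).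
Proof.
elim/big_rec2: _ => [|j a b _ IH]; first exact: multi0.
by rewrite phi_lin IH.
Qed.

Hypothesis phi_alt : alternating phi.

Lemma alt_tperm (w : {ffun 'I_k -> W}) i j : i != j -> phi [ffun m => w (tperm i j m)] = - phi w.
Proof.
move=> ij; apply/eqP; rewrite -addr_eq0.
have := @phi_alt (upd (upd w i (w i + w j)) j (w i + w j)) i j ij.
rewrite !ffunE (negPf ij) !eqxx => /(_ erefl).
rewrite multiD !(updC _ _ _ ij) !multiD.
rewrite -!(updC _ _ _ ij) => E.
have z1 : phi (upd (upd w i (w i)) j (w i)) = 0.
  by apply: (phi_alt ij); rewrite !ffunE (negPf ij) !eqxx.
have z2 : phi (upd (upd w i (w j)) j (w j)) = 0.
  by apply: (phi_alt ij); rewrite !ffunE (negPf ij) !eqxx.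
rewrite z1 z2 add0r addr0 !upd_id in E.
rewrite -E; apply/eqP; congr (phi _ + phi _).
apply/ffunP => m; rewrite !ffunE; case: tpermP => [->|->|/eqP mi /eqP mj].
- by rewrite (negPf ij) eqxx.
- by rewrite eqxx.
- by rewrite (negPf mi) (negPf mj).
Qed.

Lemma alt_perm (w : {ffun 'I_k -> W}) (s : 'S_k) : phi [ffun m => w (s m)] = (-1) ^+ s *: phi w.
Proof.
have [ts -> {s}] := prod_tpermP s; elim: ts w => [|t ts IH] w /=.
  move=> _; rewrite big_nil odd_perm1 expr0 scale1r; congr phi.
  by apply/ffunP => m; rewrite ffunE perm1.
case/andP => dt /IH{}IH; rewrite big_cons odd_mul_tperm dt signr_addb expr1.
rewrite -scalerA scaleN1r -IH -(alt_tperm _ (dt : t.1 != t.2)); congr phi.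
by apply/ffunP => m; rewrite !ffunE permM.
Qed.

End Multi.

Definition consf k (W : Type) (u : W) (w : {ffun 'I_k -> W}) : {ffun 'I_k.+1 -> W} :=
  [ffun i => oapp w u (unlift ord0 i)].

Lemma consf0 k (W : Type) (u : W) (w : {ffun 'I_k -> W}) : consf u w ord0 = u.
Proof. by rewrite ffunE unlift_none. Qed.

Lemma consf_lift k (W : Type) (u : W) (w : {ffun 'I_k -> W}) i :
  consf u w (lift ord0 i) = w i.
Proof. by rewrite ffunE liftK. Qed.

Lemma consf_upd k (W : Type) (u : W) (w : {ffun 'I_k -> W}) i v :
  consf u (upd w i v) = upd (consf u w) (lift ord0 i) v.
Proof.
apply/ffunP => j; rewrite ffunE; case: (unliftP ord0 j) => [j' ->|->] /=.
  by rewrite !ffunE liftK /= (inj_eq lift_inj).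
by rewrite !ffunE unlift_none (negPf (neq_lift _ _)).
Qed.

Lemma consf_hd k (W : Type) (u v : W) (w : {ffun 'I_k -> W}) :
  upd (consf u w) ord0 v = consf v w.
Proof.
apply/ffunP => j; rewrite !ffunE.
by case: (unliftP ord0 j) => [j' ->|->].
Qed.

Lemma consfK k (W : Type) (w : {ffun 'I_k.+1 -> W}) :
  consf (w ord0) [ffun i => w (lift ord0 i)] = w.
Proof.
apply/ffunP => j; rewrite ffunE.
by case: (unliftP ord0 j) => [j' ->|->] //=; rewrite ffunE.
Qed.

Lemma multi_expand k W U (phi : {ffun 'I_k -> W} -> U) w : multilinear phi ->
  phi w = \sum_(h : {ffun 'I_k -> 'I_(dim W)})
            (\prod_i v2r (w i) 0 (h i)) *: phi [ffun i => vbase (h i)].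
Proof.
elim: k phi w => [|k IH] phi w phi_lin.
  have all0 (T : Type) (a b : {ffun 'I_0 -> T}) : a = b by apply/ffunP => -[].
  have h0 : {ffun 'I_0 -> 'I_(dim W)} by apply: finfun => -[].
  rewrite (bigD1 h0) //= big_ord0 scale1r big1 ?addr0; first by congr phi.
  by move=> h; rewrite (all0 _ h h0) eqxx.
rewrite -{1}[w]consfK -(consf_hd 0) [w ord0]vbase_sum multi_sum //.
pose g (jh : 'I_(dim W) * {ffun 'I_k -> 'I_(dim W)}) := consf jh.1 jh.2.
rewrite (reindex g) /=; last first.
  exists (fun h => (h ord0, [ffun i => h (lift ord0 i)])) => [[j h] _|h _];
    rewrite /g /= ?consfK // consf0; congr pair.
  by apply/ffunP => i; rewrite ffunE consf_lift.
rewrite -(pair_bigA _ (fun j h => (\prod_i v2r (w i) 0 (consf j h i)) *: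
   phi [ffun i => vbase (consf j h i)])) /=.
apply: eq_bigr => j _; rewrite consf_hd.
rewrite (IH (fun t => phi (consf (vbase j) t))); last first.
  by move=> t i a u v; rewrite !consf_upd phi_lin.
rewrite scaler_sumr; apply: eq_bigr => h _.
rewrite scalerA big_ord_recl consf0; congr (_ * _ *: phi _).
  by apply: eq_bigr => i _; rewrite consf_lift ffunE.
apply/ffunP => i; rewrite !ffunE.
by case: (unlift ord0 i) => //= a; rewrite ffunE.
Qed.

Lemma incrP k d (f : incr k d) (i j : 'I_k) : (i < j)%N -> (val f i < val f j)%N.
Proof. by case: f => f /= /forallP/(_ i)/forallP/(_ j)/implyP. Qed.

Lemma incr_lt k d (f : incr k d) (i j : 'I_k) : (val f i < val f j)%N = (i < j)%N.
Proof.
case: (ltngtP i j) => [/(incrP f)->|/(incrP f)|/ord_inj ->] //.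
  by move=> lt; apply/negbTE; rewrite -leqNgt ltnW.
by rewrite ltnn.
Qed.

Lemma incr_inj k d (f : incr k d) : injective (val f).
Proof.
move=> i j e.
by case: (ltngtP i j) => [/(incrP f)|/(incrP f)|/ord_inj //]; rewrite e ltnn.
Qed.

Lemma incr_eq k d (f g : incr k d) :
  (forall i, exists j, val f i = val g j) -> f = g.
Proof.
move=> fg.
have gf : forall i, exists j, val g i = val f j.
  have E : [set val f i | i : 'I_k] = [set val g i | i : 'I_k].
    apply/eqP; rewrite eqEcard !card_imset ?leqnn ?andbT; try exact: incr_inj.
    by apply/subsetP => x /imsetP[i _ ->]; have [j ->] := fg i; apply: imset_f.
  move=> i; have : val g i \in [set val f i | i : 'I_k] by rewrite E imset_f.
  by case/imsetP => j; exists j.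
apply: val_inj; apply/ffunP => i.
have [n lt_in] := ubnP (val i); elim: n => // n IH in i lt_in *.
case: (ltngtP (val f i) (val g i)) => [lt|lt|/ord_inj //].
  have [j e] := fg i; have ji : (j < i)%N by rewrite -(incr_lt g) -e.
  have := IH j (leq_trans ji lt_in); rewrite -e => /incr_inj ij.
  by rewrite ij ltnn in ji.
have [j e] := gf i; have ji : (j < i)%N by rewrite -(incr_lt f) -e.
have := IH j (leq_trans ji lt_in); rewrite -e => /incr_inj ij.
by rewrite ij ltnn in ji.
Qed.

Lemma incr_sort k d (h : {ffun 'I_k -> 'I_d}) : injective h ->
  exists fs : incr k d * 'S_k, h = [ffun i => val fs.1 (fs.2 i)].
Proof.
move=> h_inj; pose r i := [set j : 'I_k | (h j < h i)%N].
have r_lt i : (#|r i| < k)%N.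
  rewrite -[X in (_ < X)%N]card_ord; apply: proper_card; apply/properP.
  by split; [apply/subsetP | exists i => //; rewrite inE ltnn].
pose s0 i : 'I_k := Ordinal (r_lt i).
have le_s0 i j : (h i <= h j)%N -> (s0 i <= s0 j)%N.
  move=> le; apply: subset_leq_card; apply/subsetP => m; rewrite !inE => lt.
  exact: leq_trans lt le.
have lt_s0 i j : (h i < h j)%N -> (s0 i < s0 j)%N.
  move=> lt; apply: proper_card; apply/properP; split.
    by apply/subsetP => m; rewrite !inE => /ltn_trans; apply.
  by exists i; rewrite !inE ?ltnn.
have s0_inj : injective s0.
  move=> i j e; apply: h_inj; apply: ord_inj.
  by case: (ltngtP (h i) (h j)) => // /lt_s0; rewrite e ltnn.
pose s := perm s0_inj.
pose f := [ffun i => h ((s^-1)%g i)].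
have fP : [forall i : 'I_k, forall j : 'I_k, (i < j)%N ==> (f i < f j)%N].
  apply/forallP => i; apply/forallP => j; apply/implyP => lt; rewrite !ffunE.
  rewrite ltnNge; apply/negP => /le_s0.
  by rewrite -!(permE s0_inj) -/s !permKV leqNgt lt.
exists (Sub f fP, s); apply/ffunP => i.
by rewrite ffunE SubK ffunE permK.
Qed.

Lemma big_inj_incr k d U (F : {ffun 'I_k -> 'I_d} -> U) :
  (forall h : {ffun 'I_k -> 'I_d}, ~~ injectiveb h -> F h = 0) ->
  \sum_h F h = \sum_(f : incr k d) \sum_(s : 'S_k) F [ffun i => val f (s i)].
Proof.
move=> F0; pose g (fs : incr k d * 'S_k) := [ffun i => val fs.1 (fs.2 i)].
have g_inj : injective g.
  move=> [f s] [f' s'] /ffunP e.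
  have ff : f = f'.
    apply: incr_eq => i; exists (s' ((s^-1)%g i)).
    by have := e ((s^-1)%g i); rewrite !ffunE /= permKV.
  subst f'; congr pair; apply/permP => i.
  by apply: (@incr_inj _ _ f); have := e i; rewrite !ffunE.
rewrite (bigID (mem [set g x | x : incr k d * 'S_k])) /= [X in _ + X]big1.
  rewrite addr0 (big_imset _ (in2W g_inj)) /= pair_bigA /=.
  by apply: eq_bigl.
move=> h hN; apply: F0; apply: contra hN => /injectiveP /incr_sort[fs ->].
exact: imset_f.
Qed.

Lemma ext_liftE k W U (phi : {ffun 'I_k -> W} -> U) w :
  multilinear phi -> alternating phi -> ext_lift phi (wedge w) = phi w.
Proof.
move=> phi_lin phi_alt; rewrite lfunE /= /ext_lift_fun (multi_expand w phi_lin).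
rewrite big_inj_incr; last first.
  move=> h /injectivePn[i [j ij e]].
  by rewrite (phi_alt _ i j ij) ?scaler0 // !ffunE e.
apply: eq_bigr => f _; rewrite ffunE /determinant scaler_suml.
apply: eq_bigr => s _.
have -> : [ffun i => vbase ([ffun i0 => val f (s i0)] i)] =
          [ffun i => [ffun i => vbase (val f i)] (s i)] :> {ffun 'I_k -> W}.
  by apply/ffunP => i; rewrite !ffunE.
rewrite alt_perm // scalerA mulrC; congr (_ * _ *: _).
by apply: eq_bigr => i _; rewrite mxE ffunE.
Qed.

Lemma wedge_lin k W : multilinear (@wedge k W).
Proof.
move=> w i a u v; apply/ffunP => f; rewrite !ffunE.
rewrite -[X in _ = _ + X]mul1r; apply: (@determinant_multilinear _ _ _ _ _ i).
- apply/rowP => j; rewrite !mxE !ffunE eqxx linearP !mxE mul1r.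
  by [].
- by apply/matrixP => x y; rewrite !mxE !ffunE eq_sym (negPf (neq_lift _ _)).
- by apply/matrixP => x y; rewrite !mxE !ffunE eq_sym (negPf (neq_lift _ _)).
Qed.

Lemma wedge_alt k W : alternating (@wedge k W).
Proof.
move=> w i j ij e; apply/ffunP => f; rewrite !ffunE.
by apply: (determinant_alternate ij) => m; rewrite !mxE e.
Qed.

Lemma wedge_vbase k W (f g : incr k (dim W)) :
  wedge [ffun i => vbase (val f i)] g = (f == g)%:R.
Proof.
rewrite ffunE; have [<-|fg] := eqVneq.
  rewrite (_ : \matrix_(_, _) _ = 1%:M) ?det1 //; apply/matrixP => i j.
  by rewrite !mxE ffunE v2r_vbase (inj_eq (@incr_inj _ _ f)).
have [i /existsPn iN] : exists i, ~~ [exists j, val f i == val g j].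
  apply/existsP; rewrite -negb_forall; apply: contra fg => /forallP E.
  by apply/eqP/incr_eq => i; have /existsP[j /eqP] := E i; exists j.
rewrite (expand_det_row _ i) big1 // => j _.
by rewrite !mxE ffunE v2r_vbase (negPf (iN j)) mul0r.
Qed.

Lemma ext_sum k W (x : ext k W) :
  x = \sum_f x f *: wedge [ffun i => vbase (val f i)].
Proof.
apply/ffunP => g; rewrite sum_ffunE (bigD1 g) //= big1.
  by rewrite addr0 ffunE wedge_vbase eqxx [_ *: _]mulr1.
by move=> f fg; rewrite ffunE wedge_vbase (negPf fg) [_ *: _]mulr0.
Qed.

Lemma wedge_eq k W U (f g : 'Hom(ext k W, U)) :
  (forall w, f (wedge w) = g (wedge w)) -> f = g.
Proof.
move=> fg; apply/lfunP => x; rewrite [x]ext_sum !linear_sum /=.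
by apply: eq_bigr => i _; rewrite !linearZ /= fg.
Qed.

End ExteriorPower.

Section TensorProduct.
Variable K : fieldType.
Implicit Types V W U : vectType K.

(* V (x) W as coordinate matrices in the bases underlying v2r.                *)
Definition tensor V W : vectType K := 'M[K]_(dim V, dim W).

Definition tens V W (v : V) (w : W) : tensor V W := (v2r v)^T *m v2r w.

Definition bilinear V W U (b : V -> W -> U) : Prop :=
  (forall w a v v', b (a *: v + v') w = a *: b v w + b v' w) /\
  (forall v a w w', b v (a *: w + w') = a *: b v w + b v w').

Definition tens_lift_fun V W U (b : V -> W -> U) (x : tensor V W) : U :=
  \sum_i \sum_j (x : 'M_(_, _)) i j *: b (vbase i) (vbase j).

Fact tens_lift_linear V W U (b : V -> W -> U) : linear (tens_lift_fun b).
Proof.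
move=> a x y; rewrite /tens_lift_fun scaler_sumr -big_split /=.
apply: eq_bigr => i _; rewrite scaler_sumr -big_split /=.
by apply: eq_bigr => j _; rewrite !mxE scalerDl scalerA.
Qed.
HB.instance Definition _ V W U (b : V -> W -> U) :=
  GRing.isLinear.Build K (tensor V W) U *:%R (tens_lift_fun b) (tens_lift_linear b).

Definition tens_lift V W U (b : V -> W -> U) : 'Hom(tensor V W, U) :=
  linfun (tens_lift_fun b).

Lemma sum_linear V U (f : V -> U) (I : finType) (c : I -> K) (x : I -> V) :
  (forall a v v', f (a *: v + v') = a *: f v + f v') ->
  f (\sum_i c i *: x i) = \sum_i c i *: f (x i).
Proof.
move=> fl; elim/big_rec2: _ => [|i a b _ IH]; last by rewrite fl IH.
by have := fl (-1) 0 0; rewrite scaler0 addr0 scaleN1r addNr.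
Qed.

Lemma tens_liftE V W U (b : V -> W -> U) v w :
  bilinear b -> tens_lift b (tens v w) = b v w.
Proof.
case=> bl br; rewrite lfunE /= /tens_lift_fun.
rewrite [in RHS](vbase_sum v) (@sum_linear _ _ (b^~ w)) //.
apply: eq_bigr => i _; rewrite [in RHS](vbase_sum w) sum_linear // scaler_sumr.
by apply: eq_bigr => j _; rewrite scalerA !mxE big_ord1 mxE.
Qed.

Lemma tens_bilinear V W : bilinear (@tens V W).
Proof.
split=> [w a v v'|v a w w']; rewrite /tens !linearP /=.
  by rewrite mulmxDl -scalemxAl.
by [].
Qed.

Lemma tens_vbase V W i j : tens (vbase i : V) (vbase j : W) = delta_mx i j.
Proof.
by apply/matrixP => a b; rewrite !mxE big_ord1 mxE !v2r_vbase !(eq_sym a, eq_sym b) -natrM mulnb.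
Qed.

Lemma tens_eq V W U (f g : 'Hom(tensor V W, U)) :
  (forall v w, f (tens v w) = g (tens v w)) -> f = g.
Proof.
move=> fg; apply/lfunP => x; rewrite [x]matrix_sum_delta !linear_sum /=.
apply: eq_bigr => i _; rewrite !linear_sum /=.
by apply: eq_bigr => j _; rewrite !linearZ /= -tens_vbase fg.
Qed.

Lemma tens_wedge_eq k V W U (f g : 'Hom(tensor V (ext k W), U)) :
  (forall v w, f (tens v (wedge w)) = g (tens v (wedge w))) -> f = g.
Proof.
move=> fg; apply: tens_eq => v x; rewrite [x]ext_sum.
have E (h : 'Hom(tensor V (ext k W), U)) (c : incr k (dim W) -> K) y :
    h (tens v (\sum_i c i *: y i)) = \sum_i c i *: h (tens v (y i)).
  rewrite (@sum_linear _ _ (fun z => h (tens v z))) // => a z z'.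
  by rewrite (tens_bilinear V (ext k W)).2 linearP.
by rewrite !E; apply: eq_bigr => i _; rewrite fg.
Qed.

End TensorProduct.

Section SpecialLinear.
Variables (K : fieldType) (n : nat).

Record SL := MkSL { SLval :> 'M[K]_n; SLvalP : \det SLval == 1 }.

HB.instance Definition _ := [isSub for SLval].
HB.instance Definition _ := [Choice of SL by <:].

Definition SL1 : SL := MkSL (introT eqP (det1 K n)).

Fact SLmul_subproof (A B : SL) : \det (A *m B) == 1.
Proof. by rewrite det_mulmx (eqP (SLvalP A)) (eqP (SLvalP B)) mulr1. Qed.
Definition SLmul (A B : SL) : SL := MkSL (SLmul_subproof A B).

Fact SLinv_subproof (A : SL) : \det (invmx A) == 1.
Proof. by rewrite det_inv (eqP (SLvalP A)) invr1. Qed.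
Definition SLinv (A : SL) : SL := MkSL (SLinv_subproof A).

Lemma SLunit (A : SL) : (A : 'M_n) \in unitmx.
Proof. by rewrite unitmxE (eqP (SLvalP A)) unitr1. Qed.

Fact SLmulA : associative SLmul.
Proof. by move=> A B C; apply: val_inj; rewrite /= mulmxA. Qed.
Fact SLmul1 : left_id SL1 SLmul.
Proof. by move=> A; apply: val_inj; rewrite /= mul1mx. Qed.
Fact SLmulr1 : right_id SL1 SLmul.
Proof. by move=> A; apply: val_inj; rewrite /= mulmx1. Qed.
Fact SLmulV : left_inverse SL1 SLinv SLmul.
Proof. by move=> A; apply: val_inj; rewrite /= mulVmx ?SLunit. Qed.
Fact SLmulrV : right_inverse SL1 SLinv SLmul.
Proof. by move=> A; apply: val_inj; rewrite /= mulmxV ?SLunit. Qed.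

HB.instance Definition _ :=
  isGroup.Build SL SLmulA SLmul1 SLmulr1 SLmulV SLmulrV.

End SpecialLinear.

Section QuotientSpace.
Variables (K : fieldType) (V : vectType K) (U : {vspace V}).
Local Open Scope quotient_scope.

Definition vquot := {ideal_quot U}.
HB.instance Definition _ := GRing.Zmodule.on vquot.

Definition vquot_pi (v : V) : vquot := \pi_{ideal_quot U} v.

Lemma vquot_piP v w : vquot_pi v = vquot_pi w <-> v - w \in U.
Proof. by rewrite Quotient.idealrBE; split=> /eqP. Qed.

Lemma vquot_piK (x : vquot) : vquot_pi (repr (x : {ideal_quot U})) = x.
Proof. exact: reprK. Qed.

Lemma vquot_piD v w : vquot_pi (v + w) = vquot_pi v + vquot_pi w.
Proof. by rewrite /vquot_pi raddfD. Qed.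

Definition vquot_scale (a : K) (x : vquot) : vquot :=
  vquot_pi (a *: repr (x : {ideal_quot U})).

Lemma vquot_scaleE a v : vquot_scale a (vquot_pi v) = vquot_pi (a *: v).
Proof. by apply/vquot_piP; rewrite -scalerBr memvZ //; apply/vquot_piP/vquot_piK. Qed.

Fact vquot_scaleA a b x : vquot_scale a (vquot_scale b x) = vquot_scale (a * b) x.
Proof. by rewrite -[x]vquot_piK !vquot_scaleE scalerA. Qed.
Fact vquot_scale1 : left_id 1 vquot_scale.
Proof. by move=> x; rewrite -[x]vquot_piK vquot_scaleE scale1r. Qed.
Fact vquot_scaleDr : right_distributive vquot_scale +%R.
Proof.
move=> a x y; rewrite -[x]vquot_piK -[y]vquot_piK.
by rewrite -vquot_piD !vquot_scaleE scalerDr vquot_piD.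
Qed.
Fact vquot_scaleDl x : {morph vquot_scale^~ x : a b / a + b}.
Proof.
by move=> a b; rewrite -[x]vquot_piK !vquot_scaleE scalerDl vquot_piD.
Qed.

HB.instance Definition _ := GRing.Zmodule_isLmodule.Build K vquot
  vquot_scaleA vquot_scale1 vquot_scaleDr vquot_scaleDl.

Fact vquot_pi_linear : linear vquot_pi.
Proof. by move=> a v w; rewrite vquot_piD -vquot_scaleE. Qed.
HB.instance Definition _ :=
  GRing.isLinear.Build K V vquot *:%R vquot_pi vquot_pi_linear.

Let proj := daddv_pi (U^C)%VS U.
Let coordq (x : vquot) : 'rV[K]_(dim (subvs_of (U^C)%VS)) :=
  v2r (vsproj (U^C)%VS (proj (repr (x : {ideal_quot U})))).

Let projB v : v - proj v \in U.
Proof.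
have : v \in (U^C + U)%VS by rewrite addvC addv_complf memvf.
move/(daddv_pi_add (etrans (capvC _ _) (capv_compl U))) => e.
by rewrite -{1}e addrC addKr memv_pi.
Qed.

Let projU v : v \in U -> proj v = 0.
Proof.
move=> vU; apply/eqP; rewrite -memv0 -(capv_compl U) memv_cap memv_pi andbT.
by rewrite -[proj v](subKr v) memvB.
Qed.

Let coordqE v : coordq (vquot_pi v) = v2r (vsproj (U^C)%VS (proj v)).
Proof.
have /projU/eqP : repr (vquot_pi v : {ideal_quot U}) - v \in U.
  exact/vquot_piP/vquot_piK.
by rewrite linearB subr_eq0 => /eqP e; rewrite /coordq e.
Qed.

Fact vquot_vect : Vector.axiom (dim (subvs_of (U^C)%VS)) vquot.
Proof.
exists coordq => [a x y|].
  rewrite -[x]vquot_piK -[y]vquot_piK -linearP !coordqE.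
  by rewrite !linearP.
exists (fun r => vquot_pi (vsval (r2v r))) => [x|r].
  rewrite -[x]vquot_piK coordqE v2rK vsprojK ?memv_pi //.
  by apply/vquot_piP; rewrite -memvN opprB projB.
rewrite coordqE daddv_pi_id ?vsvalK ?r2vK ?subvsP //.
by rewrite capvC capv_compl.
Qed.
HB.instance Definition _ := Lmodule_hasFinDim.Build K vquot vquot_vect.

End QuotientSpace.

Section Representations.
Variables (K : fieldType) (G : groupType).

Record rep := Rep {
  rep_space :> vectType K;
  rep_act : G -> 'End(rep_space);
  rep_act1 : rep_act 1%g = \1%VF;
  rep_actM : forall g h, rep_act (g * h)%g = (rep_act g \o rep_act h)%VF }.
Implicit Types M N : rep.

Record subrep M := Subrep {
  subrep_space :> {vspace M};
  subrep_stable : forall g v, v \in subrep_space -> rep_act M g v \in subrep_space }.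

Record rep_hom M N := RepHom {
  rep_hom_fun :> 'Hom(M, N);
  rep_hom_equiv : forall g v,
    rep_hom_fun (rep_act M g v) = rep_act N g (rep_hom_fun v) }.

Definition rep_iso M N : Prop := exists f : rep_hom M N, bijective f.

Definition irreducible M : Prop :=
  (fullv != 0 :> {vspace M})%VS /\
  forall S : subrep M, (S : {vspace M}) = 0%VS \/ (S : {vspace M}) = fullv.

Section Sub.
Variables (M : rep) (S : subrep M).

Let sub_act_fun g (x : subvs_of S) : subvs_of S :=
  Subvs (subrep_stable g (subvsP x)).

Fact sub_act_linear g : linear (sub_act_fun g).
Proof. by move=> a x y; apply: val_inj; rewrite /= !linearP. Qed.
HB.instance Definition _ g := GRing.isLinear.Build K
  (subvs_of S) (subvs_of S) *:%R (sub_act_fun g) (sub_act_linear g).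

Definition sub_act g : 'End(subvs_of S) := linfun (sub_act_fun g).

Lemma sub_actE g x : vsval (sub_act g x) = rep_act M g (vsval x).
Proof. by rewrite lfunE. Qed.

Fact sub_act1 : sub_act 1%g = \1%VF.
Proof.
by apply/lfunP => x; apply: val_inj; rewrite [LHS]sub_actE rep_act1 !id_lfunE.
Qed.
Fact sub_actM g h : sub_act (g * h)%g = (sub_act g \o sub_act h)%VF.
Proof.
apply/lfunP => x; apply: val_inj.
by rewrite [LHS]sub_actE rep_actM !comp_lfunE [RHS]sub_actE sub_actE.
Qed.

Definition rep_of_subrep : rep := Rep sub_act1 sub_actM.

End Sub.
Coercion rep_of_subrep : subrep >-> rep.

Section Quot.
Variables (M : rep) (S : subrep M).

Let quot_act_fun g (x : vquot S) : vquot S :=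
  vquot_pi S (rep_act M g (repr (x : {ideal_quot S}))).

Let quot_act_funE g v :
  quot_act_fun g (vquot_pi S v) = vquot_pi S (rep_act M g v).
Proof.
apply/vquot_piP; rewrite -linearB subrep_stable //.
exact/vquot_piP/vquot_piK.
Qed.

Fact quot_act_linear g : linear (quot_act_fun g).
Proof.
move=> a x y; rewrite -[x]vquot_piK -[y]vquot_piK -linearP !quot_act_funE.
by rewrite !linearP.
Qed.
HB.instance Definition _ g := GRing.isLinear.Build K
  (vquot S) (vquot S) *:%R (quot_act_fun g) (quot_act_linear g).

Definition quot_act g : 'End(vquot S) := linfun (quot_act_fun g).

Lemma quot_actE g v : quot_act g (vquot_pi S v) = vquot_pi S (rep_act M g v).
Proof. by rewrite lfunE /= quot_act_funE. Qed.

Fact quot_act1 : quot_act 1%g = \1%VF.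
Proof.
apply/lfunP => x; rewrite -[x]vquot_piK quot_actE rep_act1.
by rewrite !id_lfunE.
Qed.
Fact quot_actM g h : quot_act (g * h)%g = (quot_act g \o quot_act h)%VF.
Proof.
apply/lfunP => x; rewrite -[x]vquot_piK quot_actE rep_actM.
by rewrite !comp_lfunE !quot_actE.
Qed.

Definition rep_quot : rep := Rep quot_act1 quot_actM.

End Quot.

Section KerIm.
Variables (M N : rep) (f : rep_hom M N).

Fact rker_stable g v : v \in lker f -> rep_act M g v \in lker f.
Proof.
by rewrite !memv_ker rep_hom_equiv => /eqP->; rewrite linear0.
Qed.
Definition rker : subrep M := Subrep rker_stable.

Fact rimg_stable g v : v \in limg f -> rep_act N g v \in limg f.
Proof.
by case/memv_imgP => u _ ->; rewrite -rep_hom_equiv memv_img ?memvf.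
Qed.
Definition rimg : subrep N := Subrep rimg_stable.

End KerIm.

Section SubQuot.
Variables (M : rep) (S T : subrep M).

Fact subrep_in_stable g (v : subvs_of S) :
  v \in (linfun (vsval : subvs_of S -> M) @^-1: T)%VS ->
  rep_act S g v \in (linfun (vsval : subvs_of S -> M) @^-1: T)%VS.
Proof.
rewrite -!memv_preim !(lfunE (vsval : {linear _ -> _})) /=.
have -> : vsval (rep_act S g v) = rep_act M g (vsval v) := sub_actE g v.
exact: subrep_stable.
Qed.
(* T viewed inside S; only meant for T contained in S.                        *)
Definition subrep_in : subrep S := @Subrep S _ subrep_in_stable.

Definition subquot : rep := rep_quot subrep_in.

End SubQuot.

Section Tensor.
Variables M N : rep.

Definition tens_act g : 'End(tensor M N) :=
  tens_lift (fun v w => tens (rep_act M g v) (rep_act N g w)).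

Lemma tens_actE g v w :
  tens_act g (tens v w) = tens (rep_act M g v) (rep_act N g w).
Proof.
rewrite tens_liftE //; have [bl br] := tens_bilinear M N.
by split=> *; rewrite linearP ?bl ?br.
Qed.

Fact tens_act1 : tens_act 1%g = \1%VF.
Proof.
by apply: tens_eq => v w; rewrite tens_actE !rep_act1 !id_lfunE.
Qed.
Fact tens_actM g h : tens_act (g * h)%g = (tens_act g \o tens_act h)%VF.
Proof.
by apply: tens_eq => v w; rewrite comp_lfunE !tens_actE !rep_actM !comp_lfunE.
Qed.

Definition rep_tensor : rep := Rep tens_act1 tens_actM.

End Tensor.

Section Ext.
Variables (k : nat) (M : rep).

Definition ext_act g : 'End(ext k M) :=
  ext_lift (fun w : {ffun 'I_k -> M} => wedge [ffun i => rep_act M g (w i)]).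

Lemma upd_map (W U : Type) (f : W -> U) (w : {ffun 'I_k -> W}) i u :
  [ffun j => f (upd w i u j)] = upd [ffun j => f (w j)] i (f u).
Proof. by apply/ffunP => j; rewrite !ffunE; case: eqP. Qed.

Lemma ext_actE g w : ext_act g (wedge w) = wedge [ffun i => rep_act M g (w i)].
Proof.
rewrite ext_liftE // => [v i a x y|v i j ij e].
  by rewrite !upd_map linearP wedge_lin.
by apply: (wedge_alt ij); rewrite !ffunE e.
Qed.

Fact ext_act1 : ext_act 1%g = \1%VF.
Proof.
apply: wedge_eq => w; rewrite ext_actE id_lfunE; congr wedge.
by apply/ffunP => i; rewrite ffunE rep_act1 id_lfunE.
Qed.
Fact ext_actM g h : ext_act (g * h)%g = (ext_act g \o ext_act h)%VF.
Proof.
apply: wedge_eq => w; rewrite comp_lfunE !ext_actE; congr wedge.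
by apply/ffunP => i; rewrite !ffunE rep_actM comp_lfunE.
Qed.

Definition rep_ext : rep := Rep ext_act1 ext_actM.

End Ext.

Section CanonicalMaps.
Variable V : rep.

Definition wedge2 (u v : V) : rep_ext 2 V :=
  wedge [ffun i : 'I_2 => tnth [tuple u; v] i].
Definition wedge3 (u v w : V) : rep_ext 3 V :=
  wedge [ffun i : 'I_3 => tnth [tuple u; v; w] i].

Definition wedge_map_fun : 'Hom(rep_tensor V (rep_ext 2 V), rep_ext 3 V) :=
  tens_lift (fun (v : V) (x : ext 2 V) =>
    ext_lift (fun w : {ffun 'I_2 -> V} => wedge3 v (w ord0) (w ord_max)) x).

Lemma upd_wedge3 (v : V) (w : {ffun 'I_2 -> V}) :
  wedge3 v (w ord0) (w ord_max) = wedge (consf v w).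
Proof.
congr wedge; apply/ffunP => i; rewrite !ffunE.
case: (unliftP ord0 i) => [j ->|-> //]; rewrite (tnth_nth v) /=.
by case: j => -[|[|//]] //= jP; congr (w _); apply: val_inj.
Qed.

Lemma wedge_map_funE v u w :
  wedge_map_fun (tens v (wedge2 u w)) = wedge3 v u w.
Proof.
have ml (x : V) : multilinear (fun w : {ffun 'I_2 -> V} =>
    wedge3 x (w ord0) (w ord_max)).
  by move=> y i a z z'; rewrite !upd_wedge3 !consf_upd wedge_lin.
have al (x : V) : alternating (fun w : {ffun 'I_2 -> V} =>
    wedge3 x (w ord0) (w ord_max)).
  move=> y i j ij e; rewrite upd_wedge3.
  by apply: (@wedge_alt _ _ _ _ (lift ord0 i) (lift ord0 j));
    rewrite ?(inj_eq lift_inj) // !consf_lift.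
rewrite tens_liftE; first by rewrite ext_liftE // !ffunE.
split=> [x a z z'|z a x x']; last by rewrite linearP.
rewrite !lfunE /= /ext_lift_fun scaler_sumr -big_split /=.
apply: eq_bigr => f _; rewrite !upd_wedge3 -(consf_hd 0) wedge_lin !consf_hd.
by rewrite scalerDr !scalerA mulrC.
Qed.

Lemma ffun2_eta (T : Type) (w : {ffun 'I_2 -> T}) :
  w = [ffun i : 'I_2 => tnth [tuple w ord0; w ord_max] i].
Proof.
apply/ffunP => i; rewrite ffunE (tnth_nth (w ord0)).
by case: i => -[|[|//]] //= iP; congr (w _); apply: val_inj.
Qed.

Lemma ffun3_eta (T : Type) (w : {ffun 'I_3 -> T}) :
  w = [ffun i : 'I_3 => tnth [tuple w ord0; w (inord 1); w ord_max] i].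
Proof.
apply/ffunP => i; rewrite ffunE (tnth_nth (w ord0)).
by case: i => -[|[|[|//]]] //= iP; congr (w _); apply: val_inj; rewrite //= inordK.
Qed.

Lemma tens_wedge2_eq (W : vectType K) (f g : 'Hom(rep_tensor V (rep_ext 2 V), W)) :
  (forall v u w : V, f (tens v (wedge2 u w)) = g (tens v (wedge2 u w))) -> f = g.
Proof.
by move=> fg; apply: tens_wedge_eq => v w; rewrite [w]ffun2_eta; apply: fg.
Qed.

Lemma wedge3_eq (W : vectType K) (f g : 'Hom(rep_ext 3 V, W)) :
  (forall u v w : V, f (wedge3 u v w) = g (wedge3 u v w)) -> f = g.
Proof. by move=> fg; apply: wedge_eq => w; rewrite [w]ffun3_eta; apply: fg. Qed.

Lemma wedge2_act g (u v : V) :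
  rep_act (rep_ext 2 V) g (wedge2 u v) = wedge2 (rep_act V g u) (rep_act V g v).
Proof.
rewrite /= ext_actE; congr wedge; apply/ffunP => i; rewrite !ffunE !(tnth_nth u).
by case: i => -[|[|//]].
Qed.

Lemma wedge3_act g (u v w : V) :
  rep_act (rep_ext 3 V) g (wedge3 u v w) =
  wedge3 (rep_act V g u) (rep_act V g v) (rep_act V g w).
Proof.
rewrite /= ext_actE; congr wedge; apply/ffunP => i; rewrite !ffunE !(tnth_nth u).
by case: i => -[|[|[|//]]].
Qed.

Fact wedge_map_equiv g x :
  wedge_map_fun (rep_act (rep_tensor V (rep_ext 2 V)) g x) =
  rep_act (rep_ext 3 V) g (wedge_map_fun x).
Proof.
suff /lfunP/(_ x) : (wedge_map_fun \o rep_act (rep_tensor V (rep_ext 2 V)) g =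
   rep_act (rep_ext 3 V) g \o wedge_map_fun)%VF by rewrite !comp_lfunE.
apply: tens_wedge2_eq => v u w.
rewrite !comp_lfunE wedge_map_funE wedge3_act [rep_act _ g _]tens_actE.
by rewrite wedge2_act wedge_map_funE.
Qed.

Definition wedge_map : rep_hom (rep_tensor V (rep_ext 2 V)) (rep_ext 3 V) :=
  RepHom wedge_map_equiv.

Lemma wedge_mapE v u w : wedge_map (tens v (wedge2 u w)) = wedge3 v u w.
Proof. exact: wedge_map_funE. Qed.

Let emb (w : {ffun 'I_3 -> V}) : rep_tensor V (rep_ext 2 V) :=
  tens (w ord0) (wedge2 (w (inord 1)) (w ord_max))
  - tens (w (inord 1)) (wedge2 (w ord0) (w ord_max))
  + tens (w ord_max) (wedge2 (w ord0) (w (inord 1))).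

Definition ext_embed_fun : 'Hom(rep_ext 3 V, rep_tensor V (rep_ext 2 V)) :=
  ext_lift emb.

Lemma wedge2_linl a (u u' v : V) :
  wedge2 (a *: u + u') v = a *: wedge2 u v + wedge2 u' v.
Proof.
have E (x : V) : wedge2 x v = wedge (upd [ffun=> v] (ord0 : 'I_2) x).
  congr wedge; apply/ffunP => i; rewrite !ffunE (tnth_nth x).
  by case: i => -[|[|//]].
by rewrite !E wedge_lin.
Qed.

Lemma wedge2_linr a (u v v' : V) :
  wedge2 u (a *: v + v') = a *: wedge2 u v + wedge2 u v'.
Proof.
have E (x : V) : wedge2 u x = wedge (upd [ffun=> u] (ord_max : 'I_2) x).
  congr wedge; apply/ffunP => i; rewrite !ffunE (tnth_nth x).
  by case: i => -[|[|//]].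
by rewrite !E wedge_lin.
Qed.

Lemma wedge2vv (v : V) : wedge2 v v = 0.
Proof. by apply: (@wedge_alt _ _ _ _ ord0 ord_max); rewrite ?ffunE. Qed.

Lemma ord3_ind (P : 'I_3 -> Prop) :
  P ord0 -> P (inord 1) -> P ord_max -> forall i, P i.
Proof.
move=> P0 P1 P2 [[|[|[|//]]] iP].
- by rewrite (_ : Ordinal iP = ord0) //; apply: val_inj.
- by rewrite (_ : Ordinal iP = inord 1) //; apply: val_inj; rewrite /= inordK.
- by rewrite (_ : Ordinal iP = ord_max) //; apply: val_inj.
Qed.

Let o01 : (ord0 == inord 1 :> 'I_3) = false.
Proof. by rewrite -val_eqE /= inordK. Qed.
Let o12 : (inord 1 == ord_max :> 'I_3) = false.
Proof. by rewrite -val_eqE /= inordK. Qed.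

Fact emb_lin : multilinear emb.
Proof.
have [bl br] := tens_bilinear V (rep_ext 2 V).
have sumE (A : zmodType) (x y z x' y' z' : A) :
    x + x' - (y + y') + (z + z') = x - y + z + (x' - y' + z').
  by rewrite opprD (addrACA x) (addrACA (x - y)).
move=> w i a u v; rewrite /emb !scalerDr !scalerN.
elim/ord3_ind: i; rewrite !ffunE ?eqxx ?o01 ?o12 ?(eq_sym _ ord0) ?(eq_sym ord_max) ?o01 ?o12 /=.
- by rewrite !wedge2_linl bl !br sumE.
- by rewrite !wedge2_linl !wedge2_linr bl !br sumE.
- by rewrite !wedge2_linr bl !br sumE.
Qed.

Fact emb_alt : alternating emb.
Proof.
have [bl br] := tens_bilinear V (rep_ext 2 V).
have t0 (v : V) : tens v (0 : rep_ext 2 V) = 0.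
  by have := br v (-1) 0 0; rewrite scaler0 addr0 scaleN1r addNr.
have w21 (u v : V) : wedge2 v u = - wedge2 u v.
  apply/eqP; rewrite -addr_eq0; apply/eqP.
  have := wedge2vv (u + v); rewrite -[X in wedge2 (X + _)]scale1r wedge2_linl.
  rewrite -[X in _ *: wedge2 _ (X + _)]scale1r -[X in _ + wedge2 _ (X + _)]scale1r.
  by rewrite !wedge2_linr !wedge2vv scaler0 add0r addr0 !scale1r addrC.
have tN (v : V) (x : rep_ext 2 V) : tens v (- x) = - tens v x.
  by rewrite -scaleN1r -[_ *: x]addr0 br t0 addr0 scaleN1r.
move=> w i j; rewrite /emb.
elim/ord3_ind: i; elim/ord3_ind: j; rewrite ?eqxx // => _ e.
- by rewrite -e wedge2vv t0 addr0 subrr.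
- by rewrite -e wedge2vv t0 subr0 w21 tN addNr.
- by rewrite e wedge2vv t0 addr0 subrr.
- by rewrite -e wedge2vv t0 sub0r addNr.
- by rewrite e wedge2vv t0 subr0 w21 tN addNr.
- by rewrite e wedge2vv t0 sub0r addNr.
Qed.

Lemma ext_embed_funE v1 v2 v3 :
  ext_embed_fun (wedge3 v1 v2 v3) =
  tens v1 (wedge2 v2 v3) - tens v2 (wedge2 v1 v3) + tens v3 (wedge2 v1 v2).
Proof.
rewrite ext_liftE; [|exact: emb_lin|exact: emb_alt].
by rewrite /emb !ffunE !(tnth_nth v1) /= inordK.
Qed.

Fact ext_embed_equiv g x :
  ext_embed_fun (rep_act (rep_ext 3 V) g x) =
  rep_act (rep_tensor V (rep_ext 2 V)) g (ext_embed_fun x).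
Proof.
suff /lfunP/(_ x) : (ext_embed_fun \o rep_act (rep_ext 3 V) g =
   rep_act (rep_tensor V (rep_ext 2 V)) g \o ext_embed_fun)%VF
  by rewrite !comp_lfunE.
apply: wedge3_eq => u v w.
rewrite !comp_lfunE ext_embed_funE wedge3_act ext_embed_funE.
have T (a : V) (y : rep_ext 2 V) : rep_act (rep_tensor V (rep_ext 2 V)) g (tens a y) =
  tens (rep_act V g a) (rep_act (rep_ext 2 V) g y) by exact: tens_actE.
rewrite [RHS]linearD linearB.
by congr (_ - _ + _); rewrite -wedge2_act; apply: (esym (T _ _)).
Qed.

Definition ext_embed : rep_hom (rep_ext 3 V) (rep_tensor V (rep_ext 2 V)) :=
  RepHom ext_embed_equiv.

Lemma ext_embedE v1 v2 v3 :
  ext_embed (wedge3 v1 v2 v3) =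
  tens v1 (wedge2 v2 v3) - tens v2 (wedge2 v1 v3) + tens v3 (wedge2 v1 v2).
Proof. exact: ext_embed_funE. Qed.

End CanonicalMaps.

End Representations.

Section RationalModules.
Variables (K : fieldType) (n : nat).
Notation G := (SL K n).

Definition nat_act (g : G) : 'End('cV[K]_n) := linfun (mulmx (g : 'M_n)).

Lemma nat_actE g v : nat_act g v = (g : 'M_n) *m v.
Proof. by rewrite lfunE. Qed.

Fact nat_act1 : nat_act 1%g = \1%VF.
Proof. by apply/lfunP => v; rewrite nat_actE id_lfunE mul1mx. Qed.
Fact nat_actM g h : nat_act (g * h)%g = (nat_act g \o nat_act h)%VF.
Proof. by apply/lfunP => v; rewrite comp_lfunE !nat_actE mulmxA. Qed.

Definition natural_rep : rep K G := Rep nat_act1 nat_actM.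

(* Matrix coefficients are regular functions on SL_n; since det = 1 on SL_n,  *)
(* these are exactly the restrictions of polynomials in the matrix entries.   *)
Definition rational (M : rep K G) : Prop :=
  forall (phi : 'Hom(M, K^o)) (v : M), exists P : {mpoly K[n * n]},
    forall g : G, phi (rep_act M g v) = P.@[fun k => mxvec g 0 k].

(* Weights of the diagonal torus, in the coordinates given by the diagonal    *)
(* entries eps_0, ..., eps_(n - 1), hence only relevant modulo (1, ..., 1).   *)
Definition weight := {ffun 'I_n -> int}.

Definition weight_char (lam : weight) (t : G) : K := \prod_i t i i ^ lam i.

(* lambda_k = eps_0 + ... + eps_(k - 1); the Borel subgroup is the group of   *)
(* upper triangular matrices, acting on column vectors.                       *)
Definition fund_weight (k : nat) : weight := [ffun i : 'I_n => Posz (i < k)%N].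

Definition torus (t : G) : bool := is_diag_mx t.
Definition borel (b : G) : bool := is_trig_mx (b : 'M_n)^T.

Definition has_weight (M : rep K G) (lam : weight) (v : M) : Prop :=
  forall t : G, torus t -> rep_act M t v = weight_char lam t *: v.

Definition has_highest_weight (M : rep K G) (lam : weight) : Prop :=
  exists v : M, [/\ v != 0, has_weight lam v &
    forall b : G, borel b -> rep_act M b v \in <[v]>%VS].

Definition is_L (lam : weight) (M : rep K G) : Prop :=
  [/\ rational M, irreducible M & has_highest_weight M lam].

(* L(lam) exists and is isomorphic to N.                                      *)
Definition L_iso (lam : weight) (N : rep K G) : Prop :=
  (exists M, is_L lam M) /\ (forall M, is_L lam M -> rep_iso M N).

End RationalModules.

(* Main.v *)
From HB Require Import structures.
From Stdlib Require Import Classical_Prop Classical_Pred_Type.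
Require Import Defs.
From mathcomp Require Import all_boot all_order all_fingroup all_algebra.
From mathcomp Require Import mpoly generic_quotient ring_quotient ring zify.

Set Implicit Arguments.
Unset Strict Implicit.
Unset Printing Implicit Defensive.

Import GRing.Theory.
Import VectorInternalTheory.
Local Open Scope ring_scope.

(** Write E for the tensor product of V with its exterior square. An element of E
    is determined by its coefficients T(a,b,c) (tcoef, tcoord), which alternate in
    (b,c); iota identifies the exterior cube with the totally alternating ones, and
    iota after pi sends T to its sum over cyclic permutations (tcoef_iota_pi). Hence ker pi
    consists of the T with vanishing cyclic sum, im iota of the cyclically invariant T
    (mem_img_iota), and on im iota the cyclic sum is multiplication by
    3: in characteristic 3 the image of iota lies in ker pi, otherwise it meets
    ker pi trivially.

    The heart of the matter is submodule_ker: every submodule of E that is not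
    contained in im iota contains ker pi. Suppose that T(a,b,c) <> T(b,c,a) for some
    element of the submodule. The elementary matrices 1 + s E_ij act on E by
    polynomials in s of degree 2, whose coefficients preserve the submodule
    (deriv_mem); one of them, if necessary, gives an element with T(a,a,b) <> 0; two more
    isolate this coefficient and produce the tensor e_i (x) e_i /\ e_j
    (extract_pure, pure_mem). As soon as all these tensors are present, a functional
    that vanishes on the submodule is a totally alternating trilinear form, so it
    factors through pi and kills ker pi (ker_pi_sub). Therefore ker pi, or ker pi
    modulo im iota when p = 3, is irreducible; it is rational, and
    e_0 (x) e_0 /\ e_1 is a highest weight vector of weight
    lambda_1 + lambda_2 (hw_vec_weight, hw_vec_borel).

    It remains to see that an irreducible rational module is determined by its
    highest weight (is_L_unique). The argument is the classical one: in M x N,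
    the submodule S generated by the pair of highest weight vectors meets the
    weight space of lambda in a line only, so that S contains neither factor and
    is the graph of an isomorphism (graph_iso). That the weight space is a line
    (highest_weight_line) follows from two facts. The module S is spanned by the
    translates of the highest weight vector v under lower unipotent matrices,
    because the big cell is dense (big_cell_dense); and conjugation by the
    one-parameter subgroup diag(w^(2i-m)), for matrices of size m + 1, contracts each lower
    unipotent matrix to 1 as w tends to 0, so that the component of weight lambda of
    each translate is v itself. *)

(** * Functionals and spans *)

Section LinearAlgebra.
Variable K : fieldType.

Lemma linear_lfun (U W : vectType K) (f : U -> W) :
  linear f -> exists h : 'Hom(U, W), h =1 f.
Proof.
move=> fl; pose F := HB.pack_for {linear U -> W} f
  (GRing.isLinear.Build K U W *:%R f fl).
by exists (linfun F) => x; rewrite lfunE.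
Qed.

Lemma separating (U : vectType K) (X : {vspace U}) x : x \notin X ->
  exists2 psi : 'Hom(U, K^o), psi x != 0 & forall y, y \in X -> psi y = 0.
Proof.
move=> xX; have nz : v2r (x - projv X x) != 0.
  rewrite -(linear0 (@v2r K U)) (inj_eq (can_inj v2rK)) subr_eq0.
  by apply: contra xX => /eqP->; apply: memv_proj.
have [i iP] : exists i, v2r (x - projv X x) 0 i != 0.
  apply/existsP; rewrite -negb_forall; apply: contra nz => /forallP z.
  by apply/eqP/rowP => j; rewrite mxE; apply/eqP.
have [|psi psiE] := @linear_lfun U K^o (fun z => v2r (z - projv X z) 0 i).
  move=> a y z; rewrite linearP opprD addrACA -scalerBr linearP.
  by rewrite !mxE.
exists psi => [|y yX]; first by rewrite psiE.
by rewrite psiE projv_id // subrr linear0 mxE.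
Qed.

(** Among the finite subfamilies, one whose span has maximal dimension spans all
    members of the family. *)
Lemma span_family (U : vectType K) (I : Type) (f : I -> U) :
  exists s : seq I, forall i, f i \in <<[seq f i | i <- s]>>%VS.
Proof.
suff H m (s : seq I) : (dim U < \dim <<[seq f i | i <- s]>> + m)%N ->
    exists s : seq I, forall i, f i \in <<[seq f i | i <- s]>>%VS.
  by apply: (H (dim U).+1 [::]); rewrite addnS ltnS leq_addl.
elim: m s => [|m IH] s lt_dim.
  have := dimvS (subvf <<[seq f i | i <- s]>>%VS); rewrite dimvf leqNgt.
  by rewrite -[\dim _ in X in ~~ X]addn0 lt_dim.
have [|] := classic (forall i, f i \in <<[seq f i | i <- s]>>%VS); first by exists s.
case/not_all_ex_not=> i /negP iN; apply: (IH (i :: s)).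
apply: leq_trans lt_dim _; rewrite addnS -addSn leq_add2r ltnNge.
apply: contra iN; rewrite /= span_cons => le.
have /eqP E : (<<[seq f i | i <- s]>> == <[f i]> + <<[seq f i | i <- s]>>)%VS.
  by rewrite eqEdim addvSr.
by rewrite E memvE addvSl.
Qed.

End LinearAlgebra.

(** * Rational functions of one variable and generic triangular factorization *)

Section RationalCurves.
Variable K : closedFieldType.

Lemma poly_eq0_vals (q : {poly K}) : (forall s, q.[s] = 0) -> q = 0.
Proof.
move=> q0; apply/eqP; apply/negPn/negP => /closed_nonrootP[x].
by rewrite /root q0 eqxx.
Qed.

(** F is, away from the zeros of D, a polynomial divided by a power of D: the
    functions of one variable obtained by evaluating a regular function of SL_n on
    a matrix whose entries have denominator D. *)
Definition curve (D : {poly K}) (F : K -> K) : Prop :=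
  exists k (Q : {poly K}), forall s, D.[s] != 0 -> F s * D.[s] ^+ k = Q.[s].

Section Closure.
Variable D : {poly K}.

Lemma curve_poly (q : {poly K}) : curve D (horner q).
Proof. by exists 0, q => s _; rewrite expr0 mulr1. Qed.

Lemma curve_div (q : {poly K}) : curve D (fun s => q.[s] / D.[s]).
Proof. by exists 1, q => s sD; rewrite expr1 divfK. Qed.

Lemma curve_add F F' : curve D F -> curve D F' -> curve D (fun s => F s + F' s).
Proof.
move=> [k [Q QE]] [k' [Q' QE']].
exists (k + k')%N, (Q * D ^+ k' + Q' * D ^+ k) => s sD.
by rewrite hornerD !hornerM !horner_exp -QE // -QE' // exprD; ring.
Qed.

Lemma curve_mul F F' : curve D F -> curve D F' -> curve D (fun s => F s * F' s).
Proof.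
move=> [k [Q QE]] [k' [Q' QE']]; exists (k + k')%N, (Q * Q') => s sD.
by rewrite hornerM -QE // -QE' // exprD; ring.
Qed.

Lemma curve_eq F F' : F =1 F' -> curve D F -> curve D F'.
Proof. by move=> FF [k [Q QE]]; exists k, Q => s sD; rewrite -FF QE. Qed.

Lemma curve_cst (a : K) : curve D (fun=> a).
Proof. by apply: curve_eq (curve_poly a%:P) => s; rewrite hornerC. Qed.

Lemma curve_sum (I : Type) (r : seq I) (F : I -> K -> K) :
  (forall i, curve D (F i)) -> curve D (fun s => \sum_(i <- r) F i s).
Proof.
move=> cF; elim: r => [|i r IH].
  by apply: curve_eq (curve_cst 0) => s; rewrite big_nil.
by apply: curve_eq (curve_add (cF i) IH) => s; rewrite big_cons.
Qed.

Lemma curve_prod (I : Type) (r : seq I) (F : I -> K -> K) :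
  (forall i, curve D (F i)) -> curve D (fun s => \prod_(i <- r) F i s).
Proof.
move=> cF; elim: r => [|i r IH].
  by apply: curve_eq (curve_cst 1) => s; rewrite big_nil.
by apply: curve_eq (curve_mul (cF i) IH) => s; rewrite big_cons.
Qed.

Lemma curve_meval m (P : {mpoly K[m]}) (h : K -> 'I_m -> K) :
  (forall i, curve D (h^~ i)) -> curve D (fun s => P.@[h s]).
Proof.
move=> ch.
apply: (@curve_eq (fun s => \sum_(a <- msupp P) P@_a * \prod_i h s i ^+ a i)).
  by move=> s; rewrite mevalE.
apply: curve_sum => a; apply: curve_mul; first exact: curve_cst.
apply: curve_prod => i; elim: (a i) => [|e IH].
  by apply: curve_eq (curve_cst 1) => s; rewrite expr0.
by apply: curve_eq (curve_mul (ch i) IH) => s; rewrite exprS.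
Qed.

End Closure.

Lemma curve1 F : curve 1 F -> exists Q : {poly K}, forall s, F s = Q.[s].
Proof.
case=> k [Q QE]; exists Q => s; rewrite -QE ?hornerC ?oner_eq0 //.
by rewrite expr1n mulr1.
Qed.

(** After clearing the denominator this is the density of the complement of
    finitely many points of the line. *)
Lemma curve_eq0 (D q : {poly K}) F : curve D F -> q != 0 -> D != 0 ->
  (forall s, q.[s] != 0 -> D.[s] != 0 -> F s = 0) ->
  forall s, D.[s] != 0 -> F s = 0.
Proof.
move=> [k [Q QE]] q0 D0 F0 s sD.
suff /eqP : Q * (q * D) = 0.
  rewrite !mulf_eq0 (negPf q0) (negPf D0) !orbF => /eqP Q0.
  have /eqP := QE s sD; rewrite Q0 hornerC mulf_eq0 expf_eq0 (negPf sD) andbF.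
  by rewrite orbF => /eqP.
apply: poly_eq0_vals => z; rewrite !hornerM.
have [->|zq] := eqVneq q.[z] 0; first by rewrite mul0r mulr0.
have [->|zD] := eqVneq D.[z] 0; first by rewrite !mulr0.
by rewrite -QE // F0 // !mul0r.
Qed.

Definition shift_det n (A : 'M[K]_n) : {poly K} := char_poly (- A).

Lemma shift_detE n (A : 'M[K]_n) s : (shift_det A).[s] = \det (A + s%:M).
Proof.
rewrite -horner_evalE -det_map_mx; congr (\det _); apply/matrixP => i j.
rewrite !mxE /= horner_evalE !hornerE hornerMn hornerX.
by rewrite addrC opprK.
Qed.

Lemma shift_det_neq0 n (A : 'M[K]_n) : shift_det A != 0.
Proof. by rewrite monic_neq0 ?char_poly_monic. Qed.

(** Adding s to the diagonal makes every leading principal minor a monic polynomial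
    in s, so the factorization fails for finitely many s only. The induction
    removes the last row and column: the factors of the upper left block extend
    uniquely as soon as this block is invertible. *)
Lemma LU_generic n (A : 'M[K]_n) : exists2 q : {poly K}, q != 0 &
  forall s, q.[s] != 0 -> exists L U : 'M[K]_n,
    [/\ is_trig_mx L, (forall i, L i i = 1), is_trig_mx U^T & A + s%:M = L *m U].
Proof.
elim: n A => [|n IH] A.
  exists 1 => [|s _]; first exact: oner_neq0.
  exists 1%:M, 1%:M; rewrite tr_scalar_mx !scalar_mx_is_trig.
  by split=> //; [case | apply/matrixP; case].
move: A; rewrite -addn1 => A; set A' := ulsubmx A.
have [q q0 qP] := IH A'; exists (q * shift_det A') => [|s].
  by rewrite mulf_neq0 ?shift_det_neq0.
rewrite hornerM mulf_eq0 negb_or shift_detE => /andP[/qP[L [U [Lt L1 Ut E]]] dA].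
have : \det (L *m U) \is a GRing.unit by rewrite -E unitfE.
rewrite det_mulmx unitrM -!unitmxE => /andP[Lu Uu].
pose b := ursubmx A; pose c := dlsubmx A; pose d := drsubmx A.
pose c' := c *m invmx U; pose b' := invmx L *m b.
exists (block_mx L 0 c' 1%:M), (block_mx U b' 0 (d + s%:M - c' *m b')); split.
- by rewrite is_trig_block_mx // eqxx Lt scalar_mx_is_trig.
- move=> i; rewrite -[i](splitK) /=; case: (split i) => j /=.
    by rewrite block_mxEul.
  by rewrite block_mxEdr mxE eqxx.
- by rewrite tr_block_mx is_trig_block_mx // trmx0 eqxx Ut mx11_is_trig.
- rewrite -[A in LHS]submxK scalar_mx_block add_block_mx !addr0 E mulmx_block.
  rewrite !mul0mx !mulmx0 !addr0 mul1mx mulmxA mulmxV // mul1mx.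
  by rewrite -[c *m _ *m U]mulmxA mulVmx // mulmx1 [c' *m b' + _]addrC subrK.
Qed.

End RationalCurves.

(** * Highest weight vectors *)

Lemma rep_actMv (K : fieldType) (G : groupType) (E : rep K G) g h (v : E) :
  rep_act E (g * h)%g v = rep_act E g (rep_act E h v).
Proof. by rewrite rep_actM comp_lfunE. Qed.

Section HighestWeight.
Variables (K : closedFieldType) (m : nat).
Notation n := m.+1.
Notation G := (SL K n).

Definition lower_unipotent (u : G) : bool :=
  is_trig_mx (u : 'M_n) && [forall i, u i i == 1].

Lemma curve_coef D (h : K -> 'M[K]_n) (P : {mpoly K[n * n]}) :
  (forall i j, curve D (fun s => h s i j)) ->
  curve D (fun s => P.@[fun k => mxvec (h s) 0 k]).
Proof.
move=> ch; apply: curve_meval => k; case/mxvec_indexP: k => i j.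
by apply: curve_eq (ch i j) => s; rewrite mxvecE.
Qed.

(** The product of the lower unipotent and the upper triangular group is dense in
    SL_n. To reach a given g, join it to the big cell by the curve s |-> g + s, which
    has triangular factors for almost all s; dividing the last column by the
    determinant keeps the curve inside SL_n. *)
Lemma big_cell_dense (E : rep K G) (v : E) (psi : 'Hom(E, K^o)) : rational E ->
  (forall u b, lower_unipotent u -> borel b -> psi (rep_act E (u * b)%g v) = 0) ->
  forall g, psi (rep_act E g v) = 0.
Proof.
move=> ratE cell0 g; have [P PE] := ratE psi v; rewrite PE.
have [q q0 LU] := LU_generic (g : 'M_n); pose D := shift_det (g : 'M_n).
(* The determinant of g + s is 1 at s = 0, so h starts at g. *)
pose dg s : 'rV_n := \row_j if j == ord_max then D.[s]^-1 else 1.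
pose h s : 'M_n := ((g : 'M_n) + s%:M) *m diag_mx (dg s).
have D0 : D.[0] = 1 by rewrite shift_detE raddf0 addr0 (eqP (SLvalP g)).
have hE s i j : h s i j = (g i j + s *+ (i == j)) * dg s 0 j.
  by rewrite /h mul_mx_diag !mxE.
have h0 : h 0 = g.
  apply/matrixP => i j; rewrite hE mul0rn addr0 mxE D0 invr1.
  by case: ifP; rewrite mulr1.
have det_dg s : \det (diag_mx (dg s)) = D.[s]^-1.
  rewrite det_diag (bigD1 ord_max) //= mxE eqxx big1 ?mulr1 // => j /negPf jm.
  by rewrite mxE jm.
rewrite -h0; apply: (@curve_eq0 _ D q (fun s => P.@[fun k => mxvec (h s) 0 k]));
  rewrite ?shift_det_neq0 ?D0 ?oner_eq0 //.
  apply: curve_coef => i j.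
  apply: (@curve_eq _ _ (fun s => ((g i j)%:P + 'X *+ (i == j)).[s] *
     (if j == ord_max then (1 : {poly K}).[s] / D.[s] else 1))).
    by move=> s; rewrite hE mxE !hornerE hornerMn hornerX; case: ifP; rewrite ?mul1r.
  apply: curve_mul; first exact: curve_poly.
  by case: (j == ord_max); [exact: curve_div | exact: curve_cst].
move=> s qs Ds; have dh : \det (h s) == 1 by rewrite det_mulmx det_dg -shift_detE divff.
have [L [U [Lt L1 Ut E1]]] := LU s qs.
have dL : \det L == 1 by rewrite det_trig // big1.
have := cell0 (MkSL dL) ((MkSL dL)^-1 * MkSL dh)%g; rewrite mulKVg PE; apply.
  by rewrite /lower_unipotent Lt; apply/forallP => i; rewrite L1.
rewrite /borel /= /h E1 !mulmxA mulVmx ?unitmxE ?(eqP dL) ?unitr1 //.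
rewrite mul1mx; apply/is_trig_mxP => i j ij; rewrite mxE mul_mx_diag mxE.
by move/is_trig_mxP/(_ i j ij): Ut; rewrite mxE => ->; rewrite mul0r.
Qed.

Lemma big_cell_span (E : rep K G) (v : E) : rational E ->
  (forall b : G, borel b -> rep_act E b v \in <[v]>%VS) ->
  exists2 s : seq G, all lower_unipotent s &
    forall g, rep_act E g v \in <<[seq rep_act E u v | u <- s]>>%VS.
Proof.
move=> ratE Bv.
have [s sP] := span_family (fun u : {u : G | lower_unipotent u} => rep_act E (val u) v).
exists [seq val u | u <- s] => [|g].
  by apply/allP => _ /mapP[u _ ->]; apply: valP.
rewrite -map_comp; apply/negPn/negP => /separating[psi /negP gN X0].
apply/gN/eqP/(big_cell_dense ratE) => u b uL /Bv/vlineP[a bE].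
rewrite rep_actMv bE !linearZ /= (_ : psi _ = 0) ?scaler0 //; apply: X0.
exact: (sP (Sub u uL)).
Qed.

(** The exponents 2i - m have sum zero and increase with i. *)
Definition weight_curve (w : K) : 'M[K]_n :=
  diag_mx (\row_i (w ^+ (2 * i) / w ^+ m)).

Lemma weight_curve_det w : w != 0 -> \det (weight_curve w) == 1.
Proof.
move=> w0; rewrite det_diag; under eq_bigr do rewrite mxE.
rewrite prodf_div prodr_const card_ord -exprM.
suff -> : \prod_(i < n) w ^+ (2 * i) = w ^+ (m * n).
  by rewrite divff ?expf_neq0.
elim: (m) => [|k IH]; first by rewrite big_ord1 muln0 mul0n.
by rewrite big_ord_recr /= IH -exprD; congr (_ ^+ _); nia.
Qed.

(** The entry (i, j) of the conjugate is u i j w^(2(i-j)), a polynomial in w since u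
    is lower triangular, with limit the identity because u is unipotent. *)
Lemma weight_curve_conj (u : G) : lower_unipotent u -> exists uw : K -> 'M[K]_n,
  [/\ forall i j, curve 1 (fun w => uw w i j), uw 0 = 1%:M,
     (forall w, \det (uw w) == 1) &
     forall w, weight_curve w *m u = uw w *m weight_curve w].
Proof.
move=> /andP[ut /forallP u1].
have U (i j : 'I_n) : (i < j)%N -> u i j = 0 by move/is_trig_mxP: ut; apply.
exists (fun w => \matrix_(i, j) (u i j * w ^+ (2 * (i - j)))); split.
- move=> i j; apply: (@curve_eq _ _ (fun w => ((u i j)%:P * 'X^(2 * (i - j))).[w])).
    by move=> w; rewrite mxE !hornerE.
  exact: curve_poly.
- apply/matrixP => i j; rewrite !mxE.
  case: (ltngtP i j) => [ij|ij|/val_inj ->].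
  + by rewrite U // mul0r -val_eqE ltn_eqF.
  + by rewrite expr0n muln_eq0 subn_eq0 leqNgt ij mulr0 -val_eqE gtn_eqF.
  + by rewrite subnn muln0 expr0 mulr1 (eqP (u1 j)) eqxx.
- move=> w; rewrite det_trig ?big1 // => [i _|].
    by rewrite mxE subnn muln0 expr0 mulr1 (eqP (u1 i)).
  by apply/is_trig_mxP => i j ij; rewrite mxE U ?mul0r.
- move=> w; apply/matrixP => i j; rewrite mul_diag_mx mul_mx_diag !mxE.
  case: (ltnP i j) => ij; first by rewrite U // mulr0 !mul0r.
  rewrite -[in LHS](subnK ij) mulnDr exprD; ring.
Qed.

Lemma weight_char_neq0 (lam : weight n) w (w0 : w != 0) :
  weight_char lam (MkSL (weight_curve_det w0)) != 0.
Proof.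
apply/prodf_neq0 => i _; rewrite expfz_neq0 //= mxE eqxx mulr1n mxE.
by rewrite mulf_neq0 ?invr_eq0 ?expf_neq0.
Qed.

Lemma poly_const_off0 (Q : {poly K}) a :
  (forall w, w != 0 -> Q.[w] = a) -> Q.[0] = a.
Proof.
move=> QE; suff : (Q - a%:P) * 'X = 0.
  move/eqP; rewrite mulf_eq0 polyX_eq0 orbF subr_eq0 => /eqP->.
  by rewrite hornerC.
apply: poly_eq0_vals => w; rewrite !hornerE.
have [->|w0] := eqVneq w 0; first by rewrite mulr0.
by rewrite (QE w w0) subrr mul0r.
Qed.

(** The scalar by which b acts on v does not change when b is conjugated by the
    torus. Conjugating by the inverse of weight_curve w contracts b to its diagonal
    part as w tends to 0, and this diagonal part lies in the torus. *)
Lemma borel_char (E : rep K G) (lam : weight n) (v : E) : rational E -> v != 0 ->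
  has_weight lam v ->
  (forall b : G, borel b -> rep_act E b v \in <[v]>%VS) ->
  forall b : G, borel b -> rep_act E b v = weight_char lam b *: v.
Proof.
move=> ratE v0 wv Bv b bB.
have B (i j : 'I_n) : (j < i)%N -> b i j = 0.
  by move=> ji; move/is_trig_mxP/(_ j i ji): bB; rewrite mxE.
pose bw w : 'M_n := \matrix_(i, j) (b i j * w ^+ (2 * (j - i))).
have bwd w i : bw w i i = b i i by rewrite mxE subnn muln0 expr0 mulr1.
have bwt w : is_trig_mx (bw w)^T.
  by apply/is_trig_mxP => i j ij; rewrite !mxE B ?mul0r.
have dbw w : \det (bw w) == 1.
  rewrite -(eqP (SLvalP b)) -!(det_tr (b : 'M_n)) -(det_tr (bw w)) !det_trig //.
  by apply/eqP/eq_bigr => i _; rewrite !mxE subnn muln0 expr0 mulr1.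
have cbw i j : curve 1 (fun w => bw w i j).
  apply: (@curve_eq _ _ (fun w => ((b i j)%:P * 'X^(2 * (j - i))).[w])).
    by move=> w; rewrite mxE !hornerE.
  exact: curve_poly.
have bw0 : torus (MkSL (dbw 0)).
  apply/is_diag_mxP => i j ij; rewrite mxE; case: (ltngtP i j) ij => // ij _.
    by rewrite expr0n muln_eq0 subn_eq0 leqNgt ij mulr0.
  by rewrite B ?mul0r.
have bwE w : (b : 'M_n) *m weight_curve w = weight_curve w *m bw w.
  apply/matrixP => i j; rewrite mul_diag_mx mul_mx_diag !mxE.
  case: (ltnP j i) => ij; first by rewrite B // !(mul0r, mulr0).
  rewrite -[in LHS](subnK ij) mulnDr exprD; ring.
have [a aE] := vlineP _ _ (Bv b bB).
have [phi phiv _] : exists2 phi : 'Hom(E, K^o), phi v != 0 &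
    forall y, y \in 0%VS -> phi y = 0.
  by apply: separating; rewrite memv0.
have [P PE] := ratE phi v; have [Q QE] := curve1 (curve_coef P cbw).
have bwv w : w != 0 -> rep_act E (MkSL (dbw w)) v = a *: v.
  move=> w0; pose t := MkSL (weight_curve_det w0); pose c := weight_char lam t.
  have c0 : c != 0 := weight_char_neq0 lam w0.
  have tv : rep_act E t v = c *: v by apply: wv; apply: diag_mx_is_diag.
  have [a' a'E] := vlineP _ _ (Bv (MkSL (dbw w)) (bwt w)).
  rewrite a'E; congr (_ *: _).
  have : rep_act E (b * t)%g v = rep_act E (t * MkSL (dbw w))%g v.
    by congr (rep_act E _ v); apply: val_inj; rewrite /= bwE.
  rewrite !rep_actMv tv a'E !linearZ /= aE tv !scalerA => /eqP.
  rewrite -subr_eq0 -scalerBl scaler_eq0 (negPf v0) orbF subr_eq0 [a' * c]mulrC.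
  by move=> /eqP/(mulfI c0)->.
have : Q.[0] = phi (a *: v).
  by apply: poly_const_off0 => w w0; rewrite -QE -(bwv w w0) (PE (MkSL (dbw w))).
rewrite -QE; have := PE (MkSL (dbw 0)) => /= <-; rewrite wv // !linearZ /=.
move/(mulIf phiv : injective (fun c : K => c *: (phi v : K^o))) => aw.
by rewrite aE -aw; congr (_ *: _); apply: eq_bigr => i _; rewrite /= bwd.
Qed.

(** S is spanned by the translates u v with u lower unipotent. Let psi be a
    functional that kills v. Normalizing the action of weight_curve w by the
    character lam, one gets for every y in S a polynomial in w whose value at 0
    vanishes: for y = u v its value there is psi v. If x has weight lam, this
    polynomial is the constant psi x, hence psi x = 0. *)
Lemma highest_weight_line (E : rep K G) (lam : weight n) (v : E) : rational E ->
  has_weight lam v ->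
  (forall b : G, borel b -> rep_act E b v \in <[v]>%VS) ->
  exists2 S : subrep E, v \in (S : {vspace E}) &
    forall x, x \in (S : {vspace E}) -> has_weight lam x -> x \in <[v]>%VS.
Proof.
move=> ratE wv Bv; have [s sL sP] := big_cell_span ratE Bv.
pose X := <<[seq rep_act E u v | u <- s]>>%VS.
have Xact g x : x \in X -> rep_act E g x \in X.
  move/(coord_span (X := in_tuple _)) ->; rewrite linear_sum; apply: memv_suml => i _.
  have si : (i < size s)%N by have := ltn_ord i; rewrite {2}size_map.
  by rewrite linearZ memvZ // (nth_map 1%g) //= -rep_actMv sP.
exists (Subrep Xact) => [|x xX wx]; first by rewrite -[v](id_lfunE) -rep_act1 sP.
apply/negPn/negP => /separating[psi /negP psix psi0]; apply: psix.
have {psi0} psiv : psi v = 0 by rewrite psi0 ?memv_line.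
pose lim (y : E) := exists2 Q : {poly K}, Q.[0] = 0 & forall w (w0 : w != 0),
  psi ((weight_char lam (MkSL (weight_curve_det w0)))^-1 *:
    rep_act E (MkSL (weight_curve_det w0)) y) = Q.[w].
have tT w (w0 : w != 0) : torus (MkSL (weight_curve_det w0)).
  exact: diag_mx_is_diag.
have [Q Q0 QE] : lim x.
  move: (xX) => /(coord_span (X := in_tuple _)) ->; elim/big_ind: _.
  - by exists 0 => [|w w0]; rewrite horner0 // !linear0.
  - move=> y y' [Q Q0 QE] [Q' Q0' QE']; exists (Q + Q').
      by rewrite hornerD Q0 Q0' addr0.
    by move=> w w0; rewrite hornerD -QE -QE' linearD scalerDr linearD.
  - move=> i _; set a := coord _ _ _; have si : (i < size s)%N.
      by have := ltn_ord i; rewrite {2}size_map.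
    rewrite (nth_map 1%g) //; set u := nth _ _ _.
    have uL : lower_unipotent u by move/(all_nthP 1%g): sL; apply.
    have [uw [cuw uw0 duw uwE]] := weight_curve_conj uL.
    have [P PE] := ratE psi v.
    have [Q QE] := curve1 (curve_coef P cuw).
    exists (a *: Q).
      rewrite hornerZ -QE uw0; have := PE 1%g => /= <-.
      by rewrite rep_act1 id_lfunE psiv mulr0.
    move=> w w0; rewrite hornerZ -QE; have := PE (MkSL (duw w)) => /= <-.
    rewrite !linearZ /=.
    have -> : rep_act E (MkSL (weight_curve_det w0)) (rep_act E u v) =
      rep_act E (MkSL (duw w)) (rep_act E (MkSL (weight_curve_det w0)) v).
      by rewrite -!rep_actMv; congr (rep_act E _ v); apply: val_inj; rewrite /= uwE.
    by rewrite wv // !linearZ /= [X in a *: X]scalerA mulfV ?weight_char_neq0 // scale1r.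
apply/eqP; rewrite -Q0; apply/esym/poly_const_off0 => w w0.
by rewrite -(QE w w0) wx // scalerA mulVf ?weight_char_neq0 // scale1r.
Qed.

End HighestWeight.

(** * Uniqueness of the irreducible module of a given highest weight *)

Section ProductRep.
Variables (K : fieldType) (G : groupType) (M N : rep K G).

Definition prod_act_fun g (x : (M * N)%type) : (M * N)%type :=
  (rep_act M g x.1, rep_act N g x.2).

Fact prod_act_linear g : linear (prod_act_fun g).
Proof. by move=> a x y; rewrite /prod_act_fun !linearP. Qed.
HB.instance Definition _ g := GRing.isLinear.Build K (M * N)%type (M * N)%type
  *:%R (prod_act_fun g) (prod_act_linear g).

Definition prod_act g : 'End((M * N)%type) := linfun (prod_act_fun g).

Lemma prod_actE g x : prod_act g x = (rep_act M g x.1, rep_act N g x.2).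
Proof. by rewrite lfunE. Qed.

Fact prod_act1 : prod_act 1%g = \1%VF.
Proof. by apply/lfunP => -[x y]; rewrite prod_actE !rep_act1 !id_lfunE. Qed.
Fact prod_actM g h : prod_act (g * h)%g = (prod_act g \o prod_act h)%VF.
Proof. by apply/lfunP => x; rewrite comp_lfunE !prod_actE !rep_actMv. Qed.

Definition rep_prod : rep K G := Rep prod_act1 prod_actM.

(** A Goursat argument: the intersections of S with both factors and its two
    projections are submodules of irreducible modules, so S is the graph of a
    bijection. *)
Lemma graph_iso (S : subrep rep_prod) (vM : M) (vN : N) :
  irreducible M -> irreducible N -> vM != 0 -> vN != 0 ->
  (vM, vN) \in (S : {vspace rep_prod}) ->
  ((vM, 0) : rep_prod) \notin (S : {vspace rep_prod}) ->
  ((0, vN) : rep_prod) \notin (S : {vspace rep_prod}) -> rep_iso M N.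
Proof.
move=> [_ iM] [_ iN] vM0 vN0 vS notM notN.
have Sact g x y : ((x, y) : rep_prod) \in (S : {vspace rep_prod}) ->
    ((rep_act M g x, rep_act N g y) : rep_prod) \in (S : {vspace rep_prod}).
  by move/(subrep_stable g); rewrite /= prod_actE.
have [|inM inME] := @linear_lfun _ M rep_prod (fun x => (x, 0)).
  by move=> a x y; congr (_, _) => /=; rewrite scaler0 addr0.
have [|inN inNE] := @linear_lfun _ N rep_prod (fun y => (0, y)).
  by move=> a x y; congr (_, _) => /=; rewrite scaler0 addr0.
have kM x : ((x, 0) : rep_prod) \in (S : {vspace rep_prod}) -> x = 0.
  have st g z : z \in (inM @^-1: S)%VS -> rep_act M g z \in (inM @^-1: S)%VS.
    by rewrite -!memv_preim !inME => /(Sact g); rewrite linear0.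
  case: (iM (Subrep st)) => /= E.
    by rewrite -inME memv_preim E memv0 => /eqP.
  by move: notM; rewrite -inME memv_preim E memvf.
have kN y : ((0, y) : rep_prod) \in (S : {vspace rep_prod}) -> y = 0.
  have st g z : z \in (inN @^-1: S)%VS -> rep_act N g z \in (inN @^-1: S)%VS.
    by rewrite -!memv_preim !inNE => /(Sact g); rewrite linear0.
  case: (iN (Subrep st)) => /= E.
    by rewrite -inNE memv_preim E memv0 => /eqP.
  by move: notN; rewrite -inNE memv_preim E memvf.
have [|p1 p1E] := @linear_lfun _ rep_prod M (fun x => x.1); first by [].
have [|p2 p2E] := @linear_lfun _ rep_prod N (fun x => x.2); first by [].
have surjM x : exists y, ((x, y) : rep_prod) \in (S : {vspace rep_prod}).
  have st g z : z \in (p1 @: S)%VS -> rep_act M g z \in (p1 @: S)%VS.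
    case/memv_imgP => -[a b] abS ->; rewrite p1E /=.
    by apply/memv_imgP; exists (rep_act M g a, rep_act N g b); rewrite ?Sact // p1E.
  case: (iM (Subrep st)) => /= E.
    have : vM \in (p1 @: S)%VS by apply/memv_imgP; exists (vM, vN); rewrite ?p1E.
    by rewrite E memv0 (negPf vM0).
  have : x \in (p1 @: S)%VS by rewrite E memvf.
  by case/memv_imgP => -[a b] abS ->; exists b; rewrite p1E.
have surjN y : exists x, ((x, y) : rep_prod) \in (S : {vspace rep_prod}).
  have st g z : z \in (p2 @: S)%VS -> rep_act N g z \in (p2 @: S)%VS.
    case/memv_imgP => -[a b] abS ->; rewrite p2E /=.
    by apply/memv_imgP; exists (rep_act M g a, rep_act N g b); rewrite ?Sact // p2E.
  case: (iN (Subrep st)) => /= E.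
    have : vN \in (p2 @: S)%VS by apply/memv_imgP; exists (vM, vN); rewrite ?p2E.
    by rewrite E memv0 (negPf vN0).
  have : y \in (p2 @: S)%VS by rewrite E memvf.
  by case/memv_imgP => -[a b] abS ->; exists a; rewrite p2E.
have SB a b c d : ((a, b) : rep_prod) \in (S : {vspace rep_prod}) ->
    ((c, d) : rep_prod) \in (S : {vspace rep_prod}) ->
    ((a - c, b - d) : rep_prod) \in (S : {vspace rep_prod}) by exact: memvB.
have funM x y y' : ((x, y) : rep_prod) \in (S : {vspace rep_prod}) ->
    ((x, y') : rep_prod) \in (S : {vspace rep_prod}) -> y = y'.
  by move=> /SB/[apply]; rewrite subrr => /kN/eqP; rewrite subr_eq0 => /eqP.
have funN x x' y : ((x, y) : rep_prod) \in (S : {vspace rep_prod}) ->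
    ((x', y) : rep_prod) \in (S : {vspace rep_prod}) -> x = x'.
  by move=> /SB/[apply]; rewrite subrr => /kM/eqP; rewrite subr_eq0 => /eqP.
pose f x := xchoose (surjM x); pose h y := xchoose (surjN y).
have fS x : ((x, f x) : rep_prod) \in (S : {vspace rep_prod})
  by exact: (xchooseP (surjM x)).
have hS y : ((h y, y) : rep_prod) \in (S : {vspace rep_prod}).
  exact: (xchooseP (surjN y)).
have [|F FE] := @linear_lfun _ M N f.
  move=> a x y; apply: funM (fS _) _.
  exact: (memvD (memvZ a (fS x)) (fS y)).
have Feq g x : F (rep_act M g x) = rep_act N g (F x).
  by rewrite !FE; apply: funM (fS _) _; apply/Sact/fS.
exists (RepHom Feq); exists h => [x|y] /=; rewrite FE.
  by apply: funN (hS _) (fS x).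
by apply: funM (fS _) (hS y).
Qed.

End ProductRep.

Section Uniqueness.
Variables (K : closedFieldType) (m : nat).
Notation n := m.+1.
Notation G := (SL K n).

Lemma rational_prod (M N : rep K G) :
  rational M -> rational N -> rational (rep_prod M N).
Proof.
move=> rM rN phi [x y].
have [|pM pME] := @linear_lfun _ M K^o (fun x => phi (x, 0)).
  move=> a u w; rewrite -linearP; congr (phi _).
  by congr (_, _) => /=; rewrite scaler0 addr0.
have [|pN pNE] := @linear_lfun _ N K^o (fun y => phi (0, y)).
  move=> a u w; rewrite -linearP; congr (phi _).
  by congr (_, _) => /=; rewrite scaler0 addr0.
have [P PE] := rM pM x; have [Q QE] := rN pN y.
exists (P + Q) => g; rewrite mevalD -PE -QE pME pNE /= prod_actE.
apply: etrans (linearD _ _ _).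
by congr (phi _); congr (_, _) => /=; rewrite ?addr0 ?add0r.
Qed.

(** highest_weight_line is applied to the pair of highest weight vectors in the
    product; the Borel subgroup preserves its line because it acts on both
    components by the same character (borel_char). *)
Lemma is_L_unique (lam : weight n) (M N : rep K G) :
  is_L lam M -> is_L lam N -> rep_iso M N.
Proof.
move=> [rM iM [vM [vM0 wM BM]]] [rN iN [vN [vN0 wN BN]]].
pose v : rep_prod M N := (vM, vN).
have wv : has_weight lam v.
  by move=> t tT; rewrite /= prod_actE /= wM // wN.
have Bv b : borel b -> rep_act (rep_prod M N) b v \in <[v]>%VS.
  move=> bB; apply/vlineP; exists (weight_char lam b).
  rewrite /= prod_actE /= (borel_char rM vM0 wM BM bB).
  by rewrite (borel_char rN vN0 wN BN bB).
have [S vS Sl] := highest_weight_line (rational_prod rM rN) wv Bv.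
apply: (graph_iso iM iN vM0 vN0 vS).
- have w0 : has_weight lam ((vM, 0) : rep_prod M N).
    by move=> t tT; rewrite /= prod_actE /= wM // linear0; congr (_, _); rewrite scaler0.
  apply/negP => inS; have [a aE] := vlineP _ _ (Sl _ inS w0).
  have /eqP := congr1 (fun x : (M * N)%type => x.2) aE; rewrite eq_sym /=.
  rewrite scaler_eq0 (negPf vN0) orbF => /eqP a0.
  have /eqP := congr1 (fun x : (M * N)%type => x.1) aE.
  by rewrite a0 scale0r (negPf vM0).
- have w0 : has_weight lam ((0, vN) : rep_prod M N).
    by move=> t tT; rewrite /= prod_actE /= wN // linear0; congr (_, _); rewrite scaler0.
  apply/negP => inS; have [a aE] := vlineP _ _ (Sl _ inS w0).
  have /eqP := congr1 (fun x : (M * N)%type => x.1) aE; rewrite eq_sym /=.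
  rewrite scaler_eq0 (negPf vM0) orbF => /eqP a0.
  have /eqP := congr1 (fun x : (M * N)%type => x.2) aE.
  by rewrite a0 scale0r (negPf vN0).
Qed.

End Uniqueness.

(** * Trilinear coefficients of tensors *)

Lemma det2 (R : comNzRingType) (A : 'M[R]_2) :
  \det A = A ord0 ord0 * A ord_max ord_max - A ord0 ord_max * A ord_max ord0.
Proof.
rewrite (expand_det_row _ ord0) !big_ord_recl big_ord0 /cofactor !det_mx11 !mxE.
have e1 : lift ord0 ord0 = ord_max :> 'I_2 by apply: val_inj.
have e2 : lift ord_max ord0 = ord0 :> 'I_2 by apply: val_inj.
by rewrite !e1 e2 /= expr0 expr1 mul1r addr0 mulN1r mulrN.
Qed.
Lemma det3 (R : comNzRingType) (A : 'M[R]_3) (o := inord 1) :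
  \det A = A ord0 ord0 * (A o o * A ord_max ord_max - A o ord_max * A ord_max o)
    - A ord0 o * (A o ord0 * A ord_max ord_max - A o ord_max * A ord_max ord0)
    + A ord0 ord_max * (A o ord0 * A ord_max o - A o o * A ord_max ord0).
Proof.
have e1 : lift ord0 ord0 = o by apply: val_inj; rewrite /= inordK.
have e2 : lift ord0 ord_max = ord_max :> 'I_3 by apply: val_inj.
have e3 : lift o ord0 = ord0 by apply: val_inj; rewrite /= /bump inordK.
have e4 : lift o ord_max = ord_max by apply: val_inj; rewrite /= /bump inordK.
have e5 : lift ord_max ord0 = ord0 :> 'I_3 by apply: val_inj.
have e6 : lift ord_max ord_max = o :> 'I_3 by apply: val_inj; rewrite /= inordK.
have e7 : lift ord0 (lift ord0 ord0) = ord_max :> 'I_3 by apply: val_inj.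
rewrite (expand_det_row _ ord0) !big_ord_recl big_ord0 /cofactor !det2 !mxE.
rewrite e7 e1 e2 e3 e4 e5 e6.
have -> : (ord0 + o = 1)%N by rewrite /= inordK.
rewrite [(ord0 + ord0)%N]/= [(ord0 + ord_max)%N]/= expr0 expr1 sqrrN expr1n.
by rewrite !mul1r mulN1r mulrN addr0 addrA.
Qed.

Section Coordinates.
Variables (K : fieldType) (G : groupType) (V : rep K G).
Notation E := (rep_tensor V (rep_ext 2 V)).
Notation L3 := (rep_ext 3 V).
Notation pi := (wedge_map V).
Notation iota := (ext_embed V).
Notation form := 'Hom(V, K^o).
Implicit Types al be ga : form.

Definition ev al (v : V) : K := al v.

Lemma evP al c (u v : V) : ev al (c *: u + v) = c * ev al u + ev al v.
Proof. exact: (linearP al c u v). Qed.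

Lemma ev_lin c al be v : ev (c *: al + be) v = c * ev al v + ev be v.
Proof. by rewrite /ev add_lfunE scale_lfunE. Qed.

(** Coefficients are taken along arbitrary linear forms: the basis underlying v2r,
    in which exterior powers have coordinates, need not be the standard basis of
    column vectors, on which elementary matrices act simply. *)
Definition minor2_fun al be (w : {ffun 'I_2 -> V}) : K^o :=
  ev al (w ord0) * ev be (w ord_max) - ev be (w ord0) * ev al (w ord_max).

Definition minor2 al be : 'Hom(rep_ext 2 V, K^o) := ext_lift (minor2_fun al be).

Lemma ord2_ind (P : 'I_2 -> Prop) : P ord0 -> P ord_max -> forall i, P i.
Proof.
move=> P0 P1 [[|[|//]] iP].
- by rewrite (_ : Ordinal iP = ord0) //; apply: val_inj.
- by rewrite (_ : Ordinal iP = ord_max) //; apply: val_inj.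
Qed.

Fact minor2_lin al be : multilinear (minor2_fun al be).
Proof.
move=> w i a u v; rewrite /minor2_fun /GRing.scale /=.
by elim/ord2_ind: i; rewrite !ffunE /= !evP; ring.
Qed.

Fact minor2_alt al be : alternating (minor2_fun al be).
Proof.
move=> w i j; rewrite /minor2_fun.
by elim/ord2_ind: i; elim/ord2_ind: j => //= _ ->; ring.
Qed.

Lemma minor2E al be (u w : V) :
  minor2 al be (wedge2 u w) = ev al u * ev be w - ev be u * ev al w.
Proof.
rewrite ext_liftE; [|exact: minor2_lin|exact: minor2_alt].
by rewrite /minor2_fun !ffunE.
Qed.

Definition slice al : 'Hom(E, rep_ext 2 V) :=
  tens_lift (fun (v : V) (z : rep_ext 2 V) => ev al v *: z).

Lemma sliceE al (v : V) (z : rep_ext 2 V) : slice al (tens v z) = ev al v *: z.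
Proof.
rewrite tens_liftE //; split=> [w c x y|x c y y'].
  by rewrite evP scalerDl scalerA.
by rewrite scalerDr !scalerA mulrC.
Qed.

Definition tcoef al be ga (x : E) : K := minor2 be ga (slice al x).

Lemma tcoefP al be ga c x y :
  tcoef al be ga (c *: x + y) = c * tcoef al be ga x + tcoef al be ga y.
Proof. by rewrite /tcoef !linearP. Qed.

Lemma tcoefE al be ga (v u w : V) : tcoef al be ga (tens v (wedge2 u w)) =
  ev al v * (ev be u * ev ga w - ev ga u * ev be w).
Proof. by rewrite /tcoef sliceE linearZ /= minor2E. Qed.

(** All identities between coefficients are linear, so they need to be checked on
    decomposable tensors only. *)
Lemma tens_wedge2_ind (P : E -> Prop) :
  (forall a x y, P x -> P y -> P (a *: x + y)) ->
  (forall v u w : V, P (tens v (wedge2 u w))) -> forall x, P x.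
Proof.
move=> Plin Ppure x.
pose f (t : V * V * V) : E := tens t.1.1 (wedge2 t.1.2 t.2).
have [s sP] := span_family f.
have P0 : P 0.
  have -> : 0 = tens (0 : V) (wedge2 0 0 : rep_ext 2 V) :> E.
    by rewrite /tens !linear0 mul0mx.
  exact: Ppure.
have : x \in <<[seq f i | i <- s]>>%VS.
  apply/negPn/negP => /separating[psi /negP psix psi0]; case: psix.
  have -> : psi = 0%VF by apply: tens_wedge2_eq => v u w;
    rewrite zero_lfunE; apply: psi0 (sP (v, u, w)).
  by rewrite zero_lfunE.
move/(coord_span (X := in_tuple _)) ->.
elim/big_ind: _ => // [y z Py Pz|i _]; first by rewrite -[y]scale1r; apply: Plin.
have si : (i < size s)%N by have := ltn_ord i; rewrite {2}size_map.
rewrite (nth_map (0 : V * V * V)) // -[_ *: _]addr0; apply: Plin => //; exact: Ppure.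
Qed.

Lemma tcoef0 al be ga : tcoef al be ga 0 = 0.
Proof. by rewrite /tcoef !linear0. Qed.
Lemma tcoefN al be ga x : tcoef al be ga (- x) = - tcoef al be ga x.
Proof. by rewrite /tcoef !linearN. Qed.
Lemma tcoefD al be ga x y :
  tcoef al be ga (x + y) = tcoef al be ga x + tcoef al be ga y.
Proof. by rewrite /tcoef !linearD. Qed.

Ltac pure x := elim/tens_wedge2_ind: x;
  [move=> ? ? ?; rewrite ?linearP /= !tcoefP => -> ->; ring |
   move=> ? ? ?; rewrite ?wedge_mapE ?ext_embedE ?tcoefD ?tcoefN ?tcoefE ?ev_lin].

Lemma tcoefC al be ga x : tcoef al ga be x = - tcoef al be ga x.
Proof. by pure x; ring. Qed.

Lemma tcoef_alt al be x : tcoef al be be x = 0.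
Proof. by pure x; ring. Qed.

Lemma tcoef_lin1 c al al' be ga x :
  tcoef (c *: al + al') be ga x = c * tcoef al be ga x + tcoef al' be ga x.
Proof. by pure x; ring. Qed.

Lemma tcoef_lin2 c al be be' ga x :
  tcoef al (c *: be + be') ga x = c * tcoef al be ga x + tcoef al be' ga x.
Proof. by pure x; ring. Qed.

Lemma tcoef_lin3 c al be ga ga' x :
  tcoef al be (c *: ga + ga') x = c * tcoef al be ga x + tcoef al be ga' x.
Proof. by pure x; ring. Qed.

Lemma tcoef_act g al be ga x :
  tcoef al be ga (rep_act E g x) =
  tcoef (al \o rep_act V g)%VF (be \o rep_act V g)%VF (ga \o rep_act V g)%VF x.
Proof.
pure x.
rewrite [rep_act E _ _]tens_actE wedge2_act !tcoefE /ev !comp_lfunE.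
by [].
Qed.

Lemma tcoef_iota_wedge al be ga (v u w : V) : tcoef al be ga (iota (wedge3 v u w)) =
  ev al v * (ev be u * ev ga w - ev ga u * ev be w)
  - ev al u * (ev be v * ev ga w - ev ga v * ev be w)
  + ev al w * (ev be v * ev ga u - ev ga v * ev be u).
Proof. by rewrite ext_embedE !tcoefD tcoefN !tcoefE. Qed.

Lemma tcoef_iota_pi al be ga x :
  tcoef al be ga (iota (pi x)) = tcoef al be ga x + tcoef be ga al x + tcoef ga al be x.
Proof. by pure x; ring. Qed.

Lemma tcoef_iota_cyc al be ga y : tcoef be ga al (iota y) = tcoef al be ga (iota y).
Proof.
suff /lfunP/(_ y) : ((minor2 ga al \o slice be) \o iota =
  (minor2 be ga \o slice al) \o iota)%VF by rewrite !comp_lfunE.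
apply: wedge3_eq => u v w; rewrite !comp_lfunE.
rewrite -/(tcoef be ga al _) -/(tcoef al be ga _) !tcoef_iota_wedge; ring.
Qed.

Definition spanning (I : finType) (phi : I -> form) : Prop :=
  forall al, exists c : I -> K, al = \sum_i c i *: phi i.

Lemma trilinear_spanning (I : finType) (phi : I -> form)
    (F : form -> form -> form -> K) : spanning phi ->
  (forall c al al' be ga, F (c *: al + al') be ga = c * F al be ga + F al' be ga) ->
  (forall c al be be' ga, F al (c *: be + be') ga = c * F al be ga + F al be' ga) ->
  (forall c al be ga ga', F al be (c *: ga + ga') = c * F al be ga + F al be ga') ->
  (forall i j k, F (phi i) (phi j) (phi k) = 0) -> forall al be ga, F al be ga = 0.
Proof.
move=> sp F1 F2 F3 F0 al be ga.
have [[a ->] [b ->] [c ->]] := And3 (sp al) (sp be) (sp ga).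
rewrite (@sum_linear _ _ K^o (fun al => F al _ _)) => [|*]; last exact: F1.
rewrite big1 // => i _.
rewrite (@sum_linear _ _ K^o (fun be => F _ be _)) => [|*]; last exact: F2.
rewrite big1 ?scaler0 // => j _.
rewrite (@sum_linear _ _ K^o (fun ga => F _ _ ga)) => [|*]; last exact: F3.
by rewrite big1 ?scaler0 // => k _; rewrite F0 scaler0.
Qed.

Lemma tcoef_spanning (I : finType) (phi : I -> form) x : spanning phi ->
  (forall i j k, tcoef (phi i) (phi j) (phi k) x = 0) ->
  forall al be ga, tcoef al be ga x = 0.
Proof.
move=> sp; apply: (trilinear_spanning (F := fun al be ga => tcoef al be ga x) sp).
- by move=> *; apply: tcoef_lin1.
- by move=> *; apply: tcoef_lin2.
- by move=> *; apply: tcoef_lin3.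
Qed.

Lemma tcoef_cyc_spanning (I : finType) (phi : I -> form) x : spanning phi ->
  (forall i j k, tcoef (phi j) (phi k) (phi i) x = tcoef (phi i) (phi j) (phi k) x) ->
  forall al be ga, tcoef be ga al x = tcoef al be ga x.
Proof.
move=> sp cyc al be ga; apply/eqP; rewrite -subr_eq0; apply/eqP; move: al be ga.
apply: (trilinear_spanning (F := fun al be ga => tcoef be ga al x - tcoef al be ga x) sp).
1-3: by move=> *; rewrite !(tcoef_lin1, tcoef_lin2, tcoef_lin3); ring.
by move=> i j k; rewrite cyc subrr.
Qed.

(** The forms in which the coordinates of an exterior power are minors. *)
Definition vcoord_fun k (v : V) : K^o := v2r v 0 k.

Fact vcoord_linear k : linear (vcoord_fun k).
Proof. by move=> a x y; rewrite /vcoord_fun linearP !mxE. Qed.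
HB.instance Definition _ k :=
  GRing.isLinear.Build K V K^o *:%R (vcoord_fun k) (vcoord_linear k).

Definition vcoord k : form := linfun (vcoord_fun k).

Lemma vcoordE k v : ev (vcoord k) v = v2r v 0 k.
Proof. by rewrite /ev lfunE. Qed.

Lemma vcoord_spanning : spanning vcoord.
Proof.
move=> al; exists (fun k => al (vbase k)); apply/lfunP => v.
rewrite {1}[v]vbase_sum linear_sum sum_lfunE; apply: eq_bigr => k _.
by rewrite linearZ scale_lfunE /= [RHS]mulrC -vcoordE.
Qed.

Lemma ext2_coord (z : rep_ext 2 V) (f : incr 2 (dim V)) :
  z f = minor2 (vcoord (val f ord0)) (vcoord (val f ord_max)) z.
Proof.
have [|phi phiE] := @linear_lfun _ (rep_ext 2 V) K^o (fun z => z f).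
  by move=> a x y; rewrite !ffunE.
rewrite -phiE; congr (fun_of_lfun _ z); apply: wedge_eq => w.
rewrite [w]ffun2_eta -/(wedge2 _ _) minor2E phiE ffunE det2 !mxE.
by rewrite !ffunE !vcoordE.
Qed.

(** The Laplace expansion of the determinant along the first row is the formula
    that defines iota. *)
Lemma ext3_coord (y : L3) (f : incr 3 (dim V)) : y f =
  tcoef (vcoord (val f ord0)) (vcoord (val f (inord 1))) (vcoord (val f ord_max))
    (iota y).
Proof.
have [|phi phiE] := @linear_lfun _ L3 K^o (fun z => z f).
  by move=> k x z; rewrite !ffunE.
rewrite -phiE /tcoef; set al := vcoord (val f ord0); set be := vcoord (val f (inord 1)).
set ga := vcoord (val f ord_max).
suff /lfunP/(_ y) : (phi = (minor2 be ga \o slice al) \o iota)%VF.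
  by rewrite !comp_lfunE.
apply: wedge3_eq => u v w; rewrite !comp_lfunE -/(tcoef al be ga _).
rewrite tcoef_iota_wedge phiE ffunE det3 !mxE !ffunE !vcoordE.
rewrite !(tnth_nth u) /= inordK //=; ring.
Qed.

Lemma slice_sum x : x = \sum_k tens (vbase k) (slice (vcoord k) x).
Proof.
have [tl tr] := tens_bilinear V (rep_ext 2 V).
elim/tens_wedge2_ind: x => [a x y Ex Ey|v u w].
  rewrite {1}Ex {1}Ey scaler_sumr -big_split; apply: eq_bigr => i _.
  by rewrite linearP tr.
rewrite {1}(vbase_sum v) (@sum_linear _ V _ (fun z => tens z (wedge2 u w : rep_ext 2 V))).
  apply: eq_bigr => k _; rewrite sliceE vcoordE.
  by rewrite /tens linearZ /= -scalemxAr.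
by move=> c y z; rewrite tl.
Qed.

Lemma tcoef_eq0 x : (forall al be ga, tcoef al be ga x = 0) -> x = 0.
Proof.
move=> x0; rewrite (slice_sum x) big1 // => k _.
suff -> : slice (vcoord k) x = 0 by rewrite /tens !linear0.
by apply/ffunP => f; rewrite ffunE ext2_coord; apply: x0.
Qed.

Lemma iota_inj : lker iota = 0%VS.
Proof.
apply/eqP; rewrite -subv0; apply/subvP => y; rewrite memv_ker memv0 => /eqP y0.
by apply/eqP/ffunP => f; rewrite ext3_coord y0 tcoef0 ffunE.
Qed.

(** The coordinates of the preimage y are the coefficients of x at increasing
    indices. The coefficients of x and of iota y are totally alternating, so
    agreement at increasing indices implies equality. *)
Lemma mem_img_iota x :
  (forall al be ga, tcoef be ga al x = tcoef al be ga x) -> x \in limg iota.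
Proof.
move=> cyc.
pose y : L3 := [ffun f : incr 3 (dim V) => tcoef (vcoord (val f ord0))
  (vcoord (val f (inord 1))) (vcoord (val f ord_max)) x : K^o].
suff -> : x = iota y by rewrite memv_img ?memvf.
apply/eqP; rewrite -subr_eq0; apply/eqP/tcoef_eq0/(tcoef_spanning vcoord_spanning).
set z := x - iota y.
have zcyc al be ga : tcoef be ga al z = tcoef al be ga z.
  by rewrite !(tcoefD, tcoefN) cyc tcoef_iota_cyc.
have z_incr (i j k : 'I_(dim V)) : (i < j < k)%N ->
      tcoef (vcoord i) (vcoord j) (vcoord k) z = 0.
  case/andP=> ij jk; pose f := [ffun a : 'I_3 => tnth [tuple i; j; k] a].
  have fP : [forall a : 'I_3, forall b : 'I_3, (a < b)%N ==> (f a < f b)%N].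
    apply/forallP => a; apply/forallP => b; apply/implyP; rewrite !ffunE !(tnth_nth i).
    by case: a b => -[|[|[|//]]] ? [[|[|[|//]]] ?] //= _; apply: ltn_trans jk.
  have := ext3_coord y (Sub f fP); rewrite ffunE !SubK !ffunE !(tnth_nth i) /= inordK //=.
  by move=> E; rewrite tcoefD tcoefN -E subrr.
have z_lt (i j k : 'I_(dim V)) : (i < j)%N ->
      tcoef (vcoord i) (vcoord j) (vcoord k) z = 0.
  move=> ij; case: (ltngtP j k) => [jk|kj|/val_inj <-]; last exact: tcoef_alt.
    by rewrite z_incr ?ij.
  case: (ltngtP i k) => [ik|ki|/val_inj <-]; last by rewrite -zcyc tcoef_alt.
    by rewrite tcoefC z_incr ?oppr0 ?ik.
  by rewrite -zcyc -zcyc z_incr ?ki.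
move=> i j k; case: (ltngtP i j) => [ij|ji|/val_inj <-]; first exact: z_lt.
  by rewrite -zcyc tcoefC z_lt ?oppr0.
by rewrite -zcyc -zcyc tcoef_alt.
Qed.

End Coordinates.

(** * Submodules of the tensor product *)

(** The terms (i, j) and (j, i) are paired, which needs no division by 2. *)
Lemma alternating_sum (A : zmodType) n (F : 'I_n -> 'I_n -> A) :
  (forall i, F i i = 0) -> (forall i j, F i j = - F j i) ->
  \sum_i \sum_j F i j = 0.
Proof.
move=> F0 FN.
rewrite (eq_bigr (fun i : 'I_n =>
  \sum_(j < n | (j < i)%N) F i j + \sum_(j < n | (i < j)%N) F i j)).
  rewrite big_split /= (exchange_big_dep xpredT) //= -big_split big1 // => i _ /=.
  by rewrite -big_split big1 // => j _ /=; rewrite FN addNr.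
move=> i _; rewrite (bigD1 i) //= F0 add0r (bigID (fun j : 'I_n => (j < i)%N)) /=.
congr (_ + _); apply: eq_bigl => j; rewrite -val_eqE /=; lia.
Qed.

Section Natural.
Variables (K : closedFieldType) (n : nat).
Notation G := (SL K n).
Notation V := (natural_rep K n).
Notation E := (rep_tensor V (rep_ext 2 V)).
Notation pi := (wedge_map V).
Notation iota := (ext_embed V).
Notation form := 'Hom(V, K^o).

Definition crd_fun (a : 'I_n) (v : V) : K^o := (v : 'cV_n) a ord0.

Fact crd_linear a : linear (crd_fun a).
Proof. by move=> c x y; rewrite /crd_fun !mxE. Qed.
HB.instance Definition _ a :=
  GRing.isLinear.Build K V K^o *:%R (crd_fun a) (crd_linear a).

Definition crd a : form := linfun (crd_fun a).

Lemma crdE a v : ev (crd a) v = (v : 'cV_n) a ord0.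
Proof. by rewrite /ev lfunE. Qed.

Definition unit_vec (a : 'I_n) : V := delta_mx a ord0 : 'cV_n.

Lemma crd_unit a b : ev (crd a) (unit_vec b) = (a == b)%:R.
Proof. by rewrite crdE mxE eqxx andbT. Qed.

Lemma unit_vec_sum (v : V) : v = \sum_a ev (crd a) v *: unit_vec a.
Proof.
rewrite {1}(matrix_sum_delta (v : 'cV_n)); apply: eq_bigr => a _.
by rewrite big_ord1 crdE.
Qed.

Lemma crd_spanning : spanning crd.
Proof.
move=> al; exists (fun a => al (unit_vec a)); apply/lfunP => v.
rewrite {1}[v]unit_vec_sum linear_sum sum_lfunE; apply: eq_bigr => k _.
by rewrite linearZ scale_lfunE /= [RHS]mulrC.
Qed.

Definition tcoord (x : E) a b c := tcoef (crd a) (crd b) (crd c) x.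

Lemma tcoordC x a b c : tcoord x a c b = - tcoord x a b c.
Proof. by rewrite /tcoord tcoefC. Qed.

Lemma tcoord_alt x a b : tcoord x a b b = 0.
Proof. by rewrite /tcoord tcoef_alt. Qed.

Lemma tcoord_eq0 x : (forall a b c, tcoord x a b c = 0) -> x = 0.
Proof. by move=> x0; apply/tcoef_eq0/(tcoef_spanning crd_spanning). Qed.

Lemma tcoord_comb c d x y a b e :
  tcoord (c *: x + d *: y) a b e = c * tcoord x a b e + d * tcoord y a b e.
Proof. by rewrite /tcoord tcoefP -[d *: y]addr0 tcoefP tcoef0 addr0. Qed.

Lemma tcoord_inj x y : (forall a b c, tcoord x a b c = tcoord y a b c) -> x = y.
Proof.
move=> xy; apply/eqP; rewrite -subr_eq0; apply/eqP/tcoord_eq0 => a b c.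
by rewrite /tcoord tcoefD tcoefN -!/(tcoord _ _ _ _) xy subrr.
Qed.

Ltac tcoord_ring :=
  repeat match goal with |- context [tcoord ?x ?a ?b ?c] => move: (tcoord x a b c) => ? end;
  repeat match goal with |- context [(?a == ?b)%:R] => move: ((a == b)%:R : K) => ? end;
  ring.

Definition pure_unit i j k : E := tens (unit_vec i) (wedge2 (unit_vec j) (unit_vec k)).

Lemma tcoord_pure i j k a b c : tcoord (pure_unit i j k) a b c =
  (a == i)%:R * ((b == j)%:R * (c == k)%:R - (c == j)%:R * (b == k)%:R).
Proof. by rewrite /tcoord tcoefE !crd_unit. Qed.

Fact elem_det i j (s : K) : i != j ->
  \det (1%:M + s *: delta_mx i j : 'M[K]_n) == 1.
Proof.
move=> ij; set A := _ + _.
have A1 k : A k k = 1.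
  rewrite !mxE eqxx; case: eqP => [->|]; last by rewrite mulr0 addr0.
  by rewrite (negPf ij) mulr0 addr0.
case/orP: (leq_total i j) => le.
  rewrite -det_tr det_trig; first by rewrite big1 // => k _; rewrite mxE A1.
  apply/is_trig_mxP => a b ab; rewrite !mxE -[b == a]val_eqE gtn_eqF //.
  case: eqP => [bi|_]; last by rewrite mulr0 addr0.
  by case: eqP => [aj|_]; rewrite ?mulr0 ?addr0 //; subst; lia.
rewrite det_trig; first by rewrite big1 // => k _; rewrite A1.
apply/is_trig_mxP => a b ab; rewrite !mxE -[a == b]val_eqE ltn_eqF //.
case: eqP => [ai|_]; last by rewrite mulr0 addr0.
by case: eqP => [bj|_]; rewrite ?mulr0 ?addr0 //; subst; lia.
Qed.

Definition elem i j s (ij : i != j) : G := MkSL (elem_det s ij).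

Lemma crd_elem i j s (ij : i != j) a :
  (crd a \o rep_act V (elem s ij))%VF = (s * (a == i)%:R) *: crd j + crd a.
Proof.
apply/lfunP => v; rewrite comp_lfunE; apply: etrans (esym (ev_lin _ _ _ _)).
rewrite -/(ev _ _) !crdE /= nat_actE mulmxDl mul1mx mxE addrC; congr (_ + _).
rewrite -scalemxAl mxE mxE (bigD1 j) //= big1 => [|k /negPf kj].
  by rewrite mxE eqxx andbT addr0 mulrA.
by rewrite mxE kj andbF mul0r.
Qed.

Lemma tcoord_elem i j s (ij : i != j) x a b c :
  tcoord (rep_act E (elem s ij) x) a b c = tcoord x a b c +
    s * ((a == i)%:R * tcoord x j b c + (b == i)%:R * tcoord x a j c +
      (c == i)%:R * tcoord x a b j)
  + s ^+ 2 * ((a == i)%:R * ((b == i)%:R * tcoord x j j c + (c == i)%:R * tcoord x j b j)).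
Proof.
rewrite /tcoord tcoef_act !crd_elem !(tcoef_lin1, tcoef_lin2, tcoef_lin3) -!/(tcoord _ _ _ _).
rewrite !tcoord_alt; tcoord_ring.
Qed.

Definition tri (W : vectType K) (psi : 'Hom(E, W)) (u v w : V) : W :=
  psi (tens u (wedge2 v w)).

Section Trilinear.
Variables (W : vectType K) (psi : 'Hom(E, W)).

Lemma tri1 c u u' v w :
  tri psi (c *: u + u') v w = c *: tri psi u v w + tri psi u' v w.
Proof. by rewrite /tri (tens_bilinear V (rep_ext 2 V)).1 linearP. Qed.

Lemma tri2 c u v v' w :
  tri psi u (c *: v + v') w = c *: tri psi u v w + tri psi u v' w.
Proof. by rewrite /tri wedge2_linl (tens_bilinear V (rep_ext 2 V)).2 linearP. Qed.

Lemma tri3 c u v w w' :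
  tri psi u v (c *: w + w') = c *: tri psi u v w + tri psi u v w'.
Proof. by rewrite /tri wedge2_linr (tens_bilinear V (rep_ext 2 V)).2 linearP. Qed.

Lemma tri1_sum u v w :
  tri psi u v w = \sum_i ev (crd i) u *: tri psi (unit_vec i) v w.
Proof.
rewrite {1}(unit_vec_sum u) (@sum_linear _ V W (fun z => tri psi z v w)) // => *.
exact: tri1.
Qed.

Lemma tri2_sum u v w :
  tri psi u v w = \sum_i ev (crd i) v *: tri psi u (unit_vec i) w.
Proof.
rewrite {1}(unit_vec_sum v) (@sum_linear _ V W (fun z => tri psi u z w)) // => *.
exact: tri2.
Qed.

Lemma tri3_sum u v w :
  tri psi u v w = \sum_i ev (crd i) w *: tri psi u v (unit_vec i).
Proof.
rewrite {1}(unit_vec_sum w) (@sum_linear _ V W (fun z => tri psi u v z)) // => *.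
exact: tri3.
Qed.

End Trilinear.

Section Submodule.
Variable S : subrep E.
Notation S' := (S : {vspace E}).

(** The two vectors are the coefficients of s and of s^2 in the action of 1 + s E_ij,
    that is, the action of E_ij and of its divided square. Two values of s separate
    them, since K has an element t different from 0 and 1. *)
Lemma deriv_mem i j x : i != j -> x \in S' ->
  (exists2 y, y \in S' & forall a b c, tcoord y a b c =
    (a == i)%:R * tcoord x j b c + (b == i)%:R * tcoord x a j c +
      (c == i)%:R * tcoord x a b j) /\
  (exists2 y, y \in S' & forall a b c, tcoord y a b c =
    (a == i)%:R * ((b == i)%:R * tcoord x j j c + (c == i)%:R * tcoord x j b j)).
Proof.
move=> ij xS.
have [t] : exists t : K, ~~ root ('X * ('X - 1%:P)) t.
  by apply/closed_nonrootP; rewrite mulf_neq0 ?polyX_eq0 ?polyXsubC_eq0.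
rewrite rootE !hornerE => t01.
have tt0 : t ^+ 2 - t != 0 by apply: contra t01 => /eqP E1; apply/eqP; rewrite -E1; ring.
have [u uS Tu] : exists2 u : K -> E, forall s, u s \in S' & forall s a b c,
    tcoord (u s) a b c =
    s * ((a == i)%:R * tcoord x j b c + (b == i)%:R * tcoord x a j c +
      (c == i)%:R * tcoord x a b j)
  + s ^+ 2 * ((a == i)%:R * ((b == i)%:R * tcoord x j j c + (c == i)%:R * tcoord x j b j)).
  exists (fun s => rep_act E (elem s ij) x - x) => [s|s a b c].
    by rewrite memvB // subrep_stable.
  by rewrite /tcoord tcoefD tcoefN -!/(tcoord _ _ _ _) tcoord_elem; tcoord_ring.
have [q dq] : exists q : K, (t ^+ 2 - t) * q = 1 by exists (t ^+ 2 - t)^-1; apply: mulfV.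
have qE (A B : K) : (t ^+ 2 - t) * (q * A + - (q * t) * B) = A - t * B.
  by rewrite -[RHS]mul1r -dq; ring.
split; last first.
  exists (q *: u t + (- (q * t)) *: u 1) => [|a b c].
    by rewrite memvD // memvZ.
  by apply: (mulfI tt0); rewrite tcoord_comb qE !Tu; tcoord_ring.
have qE' (A B : K) : (t ^+ 2 - t) * (- q * A + (1 + q * t) * B) =
    (t ^+ 2 - t) * B - (A - t * B).
  by rewrite -[A - _]mul1r -[X in _ = _ - X * _]dq; ring.
exists ((- q) *: u t + (1 + q * t) *: u 1) => [|a b c].
  by rewrite memvD // memvZ.
by apply: (mulfI tt0); rewrite tcoord_comb qE' !Tu; tcoord_ring.
Qed.

(** The divided square of E_ia keeps only the coefficients in which a occurs twice,
    and E_jb then keeps only those whose remaining index is b. *)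
Lemma extract_pure x a b i j : x \in S' -> tcoord x a a b != 0 ->
  i != a -> i != b -> j != a -> j != b -> j != i -> pure_unit i i j \in S'.
Proof.
move=> xS xab ia ib ja jb ji.
have [_ [y yS yE]] := deriv_mem ia xS.
have [[z zS zE] _] := deriv_mem jb yS.
have -> : pure_unit i i j = (tcoord x a a b)^-1 *: z; last by rewrite memvZ.
apply: tcoord_inj => p q r; rewrite -[_ *: z]addr0 /tcoord tcoefP tcoef0 addr0.
apply: (mulfI xab); rewrite mulVKf // -!/(tcoord _ _ _ _) tcoord_pure zE !yE.
rewrite (eq_sym b i) (negPf ib) (tcoordC x a a b) /= mulr0n.
tcoord_ring.
Qed.

Hypothesis n_ge6 : (6 <= n)%N.

Lemma fresh (s : seq 'I_n) : (size s < n)%N -> exists i, i \notin s.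
Proof.
move=> lt; apply/existsP; rewrite -negb_forall; apply: contraL lt => /forallP s_all.
rewrite -leqNgt -[X in (X <= _)%N]card_ord; apply: leq_trans (card_size s).
by apply/subset_leq_card/subsetP => i _.
Qed.

(** If a, b, c are not yet of the form (a, a, b) with nonzero coefficient, E_ab merges
    b into a and turns the defect T(a,b,c) - T(b,c,a) into the coefficient at
    (a, a, c). Indices k, l that overlap a, b are reached through a disjoint pair. *)
Lemma pure_mem x a b c : x \in S' -> tcoord x a b c != tcoord x b c a ->
  forall k l, k != l -> pure_unit k k l \in S'.
Proof.
move=> xS xabc k l kl.
suff [y [a' [b' [yS yab]]]] : exists y a b, y \in S' /\ tcoord y a a b != 0.
  have [p] := @fresh [:: a'; b'; k; l] (ltnW n_ge6).
  rewrite !inE !negb_or => /and4P[pa pb pk pl].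
  have [q] := @fresh [:: a'; b'; k; l; p] n_ge6.
  rewrite !inE !negb_or => /and5P[qa qb qk ql qp].
  have pS := extract_pure yS yab pa pb qa qb qp.
  have Tp : tcoord (pure_unit p p q) p p q != 0.
    by rewrite tcoord_pure !eqxx (negPf qp) mul0r subr0 !mul1r oner_eq0.
  by apply: (extract_pure pS Tp); rewrite eq_sym.
have [ab|ab] := eqVneq a b.
  subst b; exists x; case: (eqVneq (tcoord x a a c) 0) => [E0|]; last by exists a, c.
  by exists a, c; rewrite (tcoordC x a a c) E0 oppr0 eqxx in xabc.
have [[y yS yE] _] := deriv_mem ab xS.
have [ca|/negPf ca] := eqVneq c a.
  subst c; exists x, a, b; split=> //.
  by apply: contra xabc => /eqP E0; rewrite (tcoordC x a a b) E0 tcoord_alt oppr0.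
exists y, a, c; split=> //; rewrite yE eqxx ca mul0r addr0 !mul1r (tcoordC x b c a) addrC.
by rewrite subr_eq0.
Qed.

(** A functional psi that kills the tensors e_k (x) e_k /\ e_l and their translates
    under 1 + E_ki gives a trilinear form that alternates in its first two arguments.
    It alternates in the last two by construction, so it is the pullback under pi of
    a functional on the exterior cube. *)
Lemma ker_pi_sub : (forall k l, k != l -> pure_unit k k l \in S') ->
  (lker pi <= S')%VS.
Proof.
move=> pureS; apply/subvP => x; rewrite memv_ker => /eqP pix.
apply/negPn/negP => /separating[psi /negP psix psiS]; apply: psix.
pose m := tri psi.
have mvv u v : m u v v = 0 by rewrite /m /tri wedge2vv /tens linear0 mulmx0 linear0.
have m23 u v w : m u w v = - m u v w.
  apply/eqP; rewrite -addr_eq0 addrC; apply/eqP.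
  have := mvv u (1 *: v + w); rewrite /m tri2 !tri3 -!/(m _ _ _) !mvv.
  by rewrite scaler0 add0r addr0 !scale1r.
have mu i j : m (unit_vec i) (unit_vec i) (unit_vec j) = 0.
  have [->|ij] := eqVneq i j; first exact: mvv.
  exact/psiS/pureS.
have m12u i k j : m (unit_vec k) (unit_vec i) (unit_vec j) =
    - m (unit_vec i) (unit_vec k) (unit_vec j).
  have [->|ki] := eqVneq k i; first by rewrite !mu oppr0.
  have [->|ji] := eqVneq j i; first by rewrite mvv m23 mu !oppr0.
  have [->|jk] := eqVneq j k; first by rewrite mvv m23 mu oppr0.
  have ei a : rep_act V (elem 1 ki) (unit_vec a) = (a == i)%:R *: unit_vec k + unit_vec a.
    apply/matrixP => b b'; rewrite ord1 -!crdE.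
    have -> : ev (crd b) (rep_act V (elem 1 ki) (unit_vec a)) =
      ev (crd b \o rep_act V (elem 1 ki))%VF (unit_vec a) by rewrite /ev comp_lfunE.
    rewrite crd_elem ev_lin evP !crd_unit mul1r [i == a]eq_sym [_ * (a == i)%:R]mulrC.
    by [].
  have ij : i != j by rewrite eq_sym.
  have := psiS _ (subrep_stable (elem 1 ki) (pureS i j ij)).
  rewrite [rep_act E _ _]tens_actE wedge2_act !ei eqxx (negPf ji) scale0r add0r.
  rewrite -[psi _]/(tri psi _ _ _) tri1 !tri2 -!/(m _ _ _) !mu.
  rewrite scaler0 add0r addr0 !scale1r => /eqP.
  by rewrite addr_eq0 => /eqP.
have m12w i k w : m (unit_vec k) (unit_vec i) w = - m (unit_vec i) (unit_vec k) w.
  rewrite /m [LHS]tri3_sum [in RHS]tri3_sum.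
  by rewrite -sumrN; apply: eq_bigr => j _; rewrite [tri _ _ _ _]m12u scalerN.
have mu_w i w : m (unit_vec i) (unit_vec i) w = 0.
  by rewrite /m tri3_sum big1 // => j _; rewrite [tri _ _ _ _]mu scaler0.
have mvvw v w : m v v w = 0.
  rewrite /m tri1_sum; under eq_bigr => i _ do rewrite tri2_sum scaler_sumr.
  apply: alternating_sum => [i|i j]; rewrite -!/(m _ _ _) ?mu_w ?scaler0 //.
  by rewrite (m12w j i) !scalerN !scalerA mulrC.
pose phi (w : {ffun 'I_3 -> V}) : K^o := m (w ord0) (w (inord 1)) (w ord_max).
have o01 : (ord0 == inord 1 :> 'I_3) = false by rewrite -val_eqE /= inordK.
have o12 : (inord 1 == ord_max :> 'I_3) = false by rewrite -val_eqE /= inordK.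
have phi_lin : multilinear phi.
  move=> w i c u v; rewrite /phi.
  by elim/ord3_ind: i; rewrite !ffunE ?eqxx ?o01 ?o12 ?(eq_sym _ ord0)
    ?(eq_sym ord_max) ?o01 ?o12 /= /m ?(tri1, tri2, tri3).
have phi_alt : alternating phi.
  move=> w i j; rewrite /phi.
  elim/ord3_ind: i; elim/ord3_ind: j; rewrite ?eqxx // => _ E0;
    by rewrite ?E0 ?mvv ?mvvw // m23 ?E0 ?mvvw ?mvv ?oppr0 // -?E0 ?mvvw ?oppr0.
have psiE : psi = (ext_lift phi \o pi)%VF.
  apply: tens_wedge2_eq => u v w; rewrite comp_lfunE wedge_mapE.
  by rewrite ext_liftE // /phi !ffunE !(tnth_nth u) /= inordK.
by rewrite psiE comp_lfunE pix linear0.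
Qed.

End Submodule.

Lemma cyc_or_not (x : E) :
  x \in limg iota \/ exists a b c, tcoord x a b c != tcoord x b c a.
Proof.
have [cyc|] := boolP [forall a, forall b, forall c, tcoord x a b c == tcoord x b c a].
  left; apply/mem_img_iota/(tcoef_cyc_spanning crd_spanning) => a b c; apply/esym/eqP.
  by have /forallP/(_ a)/forallP/(_ b)/forallP/(_ c) := cyc.
rewrite negb_forall => /existsP[a]; rewrite negb_forall => /existsP[b].
by rewrite negb_forall => /existsP[c abc]; right; exists a, b, c.
Qed.

End Natural.

Arguments crd {K n} a.
Arguments unit_vec {K n} a.
Arguments pure_unit {K n} i j k.

(** * Subquotients: irreducibility, rationality, highest weights *)

Lemma vquot_pi_surj (K : fieldType) (V : vectType K) (U : {vspace V}) (y : vquot U) :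
  exists x, y = vquot_pi U x.
Proof. by exists (repr (y : {ideal_quot U})); rewrite vquot_piK. Qed.

Section Irreducibility.
Variables (K : fieldType) (G : groupType) (M : rep K G).

(** Submodules of S, seen in M through the inclusion. *)
Lemma irreducible_sub (S : subrep M) : (S : {vspace M}) != 0%VS ->
  (forall W : subrep M, (W <= S)%VS -> (W : {vspace M}) != 0%VS -> (S <= W)%VS) ->
  irreducible S.
Proof.
move=> S0 minS; split=> [|W].
  apply: contra S0 => /eqP S0; rewrite -subv0; apply/subvP => x xS.
  have := memvf (Subvs xS : S); rewrite S0 !memv0 => /eqP/(congr1 vsval) /= ->.
  by rewrite eqxx.
pose inc : 'Hom(S, M) := linfun (vsval : subvs_of S -> M).
have incE x : inc x = vsval x by rewrite lfunE.
have st g v : v \in (inc @: W)%VS -> rep_act M g v \in (inc @: W)%VS.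
  case/memv_imgP => x xW ->; rewrite incE -[rep_act M g _](sub_actE g x) -incE.
  by rewrite memv_img // subrep_stable.
have [W0|WN0] := eqVneq (inc @: W)%VS 0%VS.
  left; apply/eqP; rewrite -subv0; apply/subvP => x xW.
  have : inc x \in (inc @: W)%VS by rewrite memv_img.
  by rewrite W0 !memv0 incE -{1}(linear0 (vsval : subvs_of S -> M)) (inj_eq val_inj).
right; apply/eqP; rewrite eqEsubv subvf; apply/subvP => x _.
have : (S <= inc @: W)%VS.
  apply: (minS (Subrep st)) => //; apply/subvP => _ /memv_imgP[y _ ->].
  by rewrite incE; apply: subvsP.
move/subvP/(_ _ (subvsP x))/memv_imgP => [y yW].
by rewrite incE => /val_inj ->.
Qed.

(** Submodules of the quotient correspond to submodules of M above S. *)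
Lemma irreducible_quot (S : subrep M) : ~~ (fullv <= S)%VS ->
  (forall W : subrep M, (S <= W)%VS -> ~~ (W <= S)%VS -> (fullv <= W)%VS) ->
  irreducible (rep_quot S).
Proof.
move=> SN maxS.
pose p : 'Hom(M, rep_quot S) := linfun (vquot_pi S).
have pE x : p x = vquot_pi S x by rewrite lfunE.
have p0 x : (p x == 0) = (x \in (S : {vspace M})).
  rewrite pE -(linear0 (vquot_pi S)).
  by apply/eqP/idP => [/vquot_piP|xS]; [|apply/vquot_piP]; rewrite subr0.
have psurj y : exists x, y = p x.
  by have [x ->] := vquot_pi_surj y; exists x; rewrite pE.
split=> [|W].
  apply: contra SN => /eqP f0; apply/subvP => x _.
  by rewrite -p0 -memv0 -f0 memvf.
have st g v : v \in (p @^-1: W)%VS -> rep_act M g v \in (p @^-1: W)%VS.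
  by rewrite -!memv_preim !pE -quot_actE => /(subrep_stable g).
have [WS|WNS] := boolP (p @^-1: W <= S)%VS.
  left; apply/eqP; rewrite -subv0; apply/subvP => y yW.
  have [x xE] := psurj y; rewrite memv0 xE p0.
  by move/subvP: WS; apply; rewrite -memv_preim -xE.
right; apply/eqP; rewrite eqEsubv subvf; apply/subvP => y _.
have [x ->] := psurj y; rewrite memv_preim.
have /subvP : (fullv <= p @^-1: W)%VS.
  apply: (maxS (Subrep st)) => //; apply/subvP => z; rewrite -p0 -memv_preim.
  by move=> /eqP->; apply: mem0v.
by apply; apply: memvf.
Qed.

End Irreducibility.

Section Subquotient.
Variables (K : fieldType) (G : groupType) (M : rep K G).

Lemma mem_subrep_in (S T : subrep M) (x : S) :
  (x \in (subrep_in S T : {vspace S})) = (vsval x \in (T : {vspace M})).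
Proof. by rewrite /= -memv_preim lfunE. Qed.

Lemma irreducible_subquot (S T : subrep M) : ~~ (S <= T)%VS ->
  (forall W : subrep M, (W <= S)%VS -> ~~ (W <= T)%VS -> (S <= W)%VS) ->
  irreducible (subquot S T).
Proof.
move=> ST minS; apply: irreducible_quot => [|W _ WT].
  apply: contra ST => /subvP ST; apply/subvP => x xS.
  by have := ST (Subvs xS : S) (memvf _); rewrite mem_subrep_in.
pose inc : 'Hom(S, M) := linfun (vsval : subvs_of S -> M).
have incE x : inc x = vsval x by rewrite lfunE.
have st g v : v \in (inc @: W)%VS -> rep_act M g v \in (inc @: W)%VS.
  case/memv_imgP => x xW ->; rewrite incE -[rep_act M g _](sub_actE g x) -incE.
  by rewrite memv_img // subrep_stable.
apply/subvP => x _.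
have : (S <= inc @: W)%VS.
  apply: (minS (Subrep st)) => /=.
    by apply/subvP => _ /memv_imgP[y _ ->]; rewrite incE; apply: subvsP.
  apply: contra WT => /subvP WT; apply/subvP => y yW.
  by rewrite mem_subrep_in -incE; apply: WT; rewrite memv_img.
move/subvP/(_ _ (subvsP x))/memv_imgP => [y yW].
by rewrite incE => /val_inj ->.
Qed.

End Subquotient.

Section Inherit.
Variables (K : fieldType) (n : nat).
Notation G := (SL K n).
Variables (M : rep K G) (S : subrep M).

Lemma rational_sub : rational M -> rational S.
Proof.
move=> rM phi v.
have [P PE] := rM (phi \o linfun (vsproj S))%VF (vsval v).
exists P => g; rewrite -PE comp_lfunE; congr (phi _).
have E x : linfun (vsproj S) x = vsproj S x by rewrite lfunE.
by rewrite E -(sub_actE g v) vsvalK.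
Qed.

Lemma rational_quot : rational M -> rational (rep_quot S).
Proof.
move=> rM phi y; have [v ->] := vquot_pi_surj y.
have [P PE] := rM (phi \o linfun (vquot_pi S))%VF v.
have E x : linfun (vquot_pi S) x = vquot_pi S x by rewrite lfunE.
by exists P => g; rewrite -PE comp_lfunE E -quot_actE.
Qed.

Lemma highest_weight_sub lam (v : M) : v \in (S : {vspace M}) -> v != 0 ->
  has_weight lam v -> (forall b : G, borel b -> rep_act M b v \in <[v]>%VS) ->
  has_highest_weight S lam.
Proof.
move=> vS v0 wv Bv; exists (Subvs vS : S); split.
- by apply: contra v0 => /eqP/(congr1 vsval) /= ->; rewrite ?linear0.
- by move=> t tT; apply: val_inj; apply: etrans (sub_actE _ _) _; rewrite /= wv.
- move=> b /Bv/vlineP[a aE]; apply/vlineP; exists a; apply: val_inj.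
  by apply: etrans (sub_actE _ _) _; rewrite /= aE.
Qed.

Lemma highest_weight_quot lam (v : M) : v \notin (S : {vspace M}) ->
  has_weight lam v -> (forall b : G, borel b -> rep_act M b v \in <[v]>%VS) ->
  has_highest_weight (rep_quot S) lam.
Proof.
move=> vS wv Bv; exists (vquot_pi S v); split.
- apply: contra vS => /eqP; rewrite -(linear0 (vquot_pi S)) => /vquot_piP.
  by rewrite subr0.
- by move=> t tT; rewrite [LHS]quot_actE wv // linearZ.
- move=> b /Bv/vlineP[a aE]; apply/vlineP; exists a.
  by rewrite [LHS]quot_actE aE linearZ.
Qed.

End Inherit.

Section NaturalModule.
Variables (K : closedFieldType) (m : nat).
Notation n := m.+1.
Notation G := (SL K n).
Notation V := (natural_rep K n).
Notation E := (rep_tensor V (rep_ext 2 V)).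

Definition regular (f : G -> K) : Prop :=
  exists P : {mpoly K[n * n]}, forall g : G, f g = P.@[fun k => mxvec g 0 k].

Lemma regular_cst a : regular (fun=> a).
Proof. by exists a%:MP => g; rewrite mevalC. Qed.

Lemma regularD f f' : regular f -> regular f' -> regular (fun g => f g + f' g).
Proof. by move=> [P PE] [Q QE]; exists (P + Q) => g; rewrite mevalD PE QE. Qed.

Lemma regularM f f' : regular f -> regular f' -> regular (fun g => f g * f' g).
Proof. by move=> [P PE] [Q QE]; exists (P * Q) => g; rewrite mevalM PE QE. Qed.

Lemma regular_eq f f' : f =1 f' -> regular f -> regular f'.
Proof. by move=> ff [P PE]; exists P => g; rewrite -ff. Qed.

Lemma regular_sum (I : finType) (f : I -> G -> K) :
  (forall i, regular (f i)) -> regular (fun g => \sum_i f i g).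
Proof.
move=> rf; elim: (index_enum I) => [|i r IH].
  by apply: regular_eq (regular_cst 0) => g; rewrite big_nil.
by apply: regular_eq (regularD (rf i) IH) => g; rewrite big_cons.
Qed.

Lemma regular_entry i j : regular (fun g => g i j).
Proof. by exists 'X_(mxvec_index i j) => g; rewrite mevalXU mxvecE. Qed.

Lemma regular_crd (v : V) i : regular (fun g => ev (crd i) (rep_act V g v)).
Proof.
apply: (@regular_eq (fun g => \sum_j g i j * (v : 'cV_n) j ord0)).
  by move=> g; rewrite crdE /= nat_actE mxE.
by apply: regular_sum => j; apply/regularM/regular_cst/regular_entry.
Qed.

(** Expanding a decomposable tensor in the standard basis exhibits a matrix
    coefficient as a cubic polynomial in the entries of g. *)
Lemma rational_tensor : rational E.
Proof.
move=> phi; elim/tens_wedge2_ind => [a x y [P PE] [Q QE]|v u w].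
  exists (a *: P + Q) => g; rewrite mevalD mevalZ -PE -QE.
  by rewrite !linearP.
suff [P PE] : regular (fun g => tri phi (rep_act V g v) (rep_act V g u) (rep_act V g w)).
  by exists P => g; rewrite -PE [rep_act E _ _]tens_actE wedge2_act.
apply: (@regular_eq (fun g => \sum_i \sum_j \sum_k ev (crd i) (rep_act V g v) *
  (ev (crd j) (rep_act V g u) * (ev (crd k) (rep_act V g w) *
     tri phi (unit_vec i) (unit_vec j) (unit_vec k))))).
  move=> g; rewrite tri1_sum; apply: eq_bigr => i _.
  rewrite tri2_sum scaler_sumr; apply: eq_bigr => j _.
  by rewrite tri3_sum !scaler_sumr.
do 3 (apply: regular_sum => ?).
by do 3 (apply: regularM; first exact: regular_crd); apply: regular_cst.
Qed.

End NaturalModule.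

(** * The kernel of the wedge map *)

Section KernelOfWedge.
Variables (K : closedFieldType) (m : nat).
Notation n := m.+1.
Notation G := (SL K n).
Notation V := (natural_rep K n).
Notation E := (rep_tensor V (rep_ext 2 V)).
Notation pi := (wedge_map V).
Notation iota := (ext_embed V).
Notation lambda12 := (fund_weight n 1 + fund_weight n 2 : weight n).
Hypothesis n_ge6 : (6 <= n)%N.

Let i1 : 'I_n := inord 1.
Definition hw_vec : E := pure_unit ord0 ord0 i1.

Let i1E : i1 = 1%N :> nat.
Proof. by rewrite inordK // (leq_trans _ n_ge6). Qed.

Let i10 : (i1 == ord0) = false.
Proof. by rewrite -val_eqE /= i1E. Qed.

Lemma borel_hw_vec (b : G) : borel b ->
  rep_act E b hw_vec = (b ord0 ord0 * b ord0 ord0 * b i1 i1) *: hw_vec.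
Proof.
move=> /is_trig_mxP bB.
have B (i j : 'I_n) : (j < i)%N -> b i j = 0.
  by move=> ji; have := bB j i ji; rewrite mxE.
have bcrd p a : ev (crd p) (rep_act V b (unit_vec a)) = b p a.
  rewrite crdE /= nat_actE mxE (bigD1 a) //= big1 ?addr0 => [|k ka].
    by rewrite mxE !eqxx mulr1.
  by rewrite mxE (negPf ka) mulr0.
have b0 p : b p ord0 = (p == ord0)%:R * b ord0 ord0.
  by have [->|p0] := eqVneq p ord0; rewrite ?mul1r // mul0r B // lt0n.
have b1 p : b p i1 = (p == ord0)%:R * b ord0 i1 + (p == i1)%:R * b i1 i1.
  have [->|p0] := eqVneq p ord0; first by rewrite eq_sym i10 mul0r addr0 mul1r.
  have [->|p1] := eqVneq p i1; first by rewrite mul0r add0r mul1r.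
  rewrite !mul0r addr0 B // i1E ltn_neqAle lt0n -{1}i1E eq_sym.
  by rewrite (inj_eq val_inj) p1.
apply: tcoord_inj => p q r; rewrite -[_ *: hw_vec]addr0 /tcoord tcoefP tcoef0 addr0.
rewrite -!/(tcoord _ _ _ _) tcoord_pure [rep_act E _ _]tens_actE wedge2_act /tcoord tcoefE !bcrd.
rewrite (b0 p) (b0 q) (b0 r) (b1 q) (b1 r); move: (b ord0 ord0) (b ord0 i1) (b i1 i1) => x y z.
by case: (p == _); case: (q == ord0); case: (q == i1); case: (r == ord0);
  case: (r == i1); rewrite /= ?mulr0n ?mulr1n; ring.
Qed.

Lemma hw_vec_weight : has_weight lambda12 hw_vec.
Proof.
move=> t tT; have tB : borel t.
  by move: tT; rewrite /torus is_diag_mxEtrig => /andP[].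
rewrite borel_hw_vec //; congr (_ *: _); rewrite /weight_char.
rewrite (bigD1 ord0) //= (bigD1 i1) ?i10 //= big1 ?mulr1 => [|i /andP[i0 ii1]].
  by rewrite !ffunE /= i1E.
rewrite !ffunE; have : (1 < i)%N.
  by rewrite ltn_neqAle lt0n -{1}i1E eq_sym (inj_eq val_inj) ii1.
by case: (nat_of_ord i) => [|[|]].
Qed.

Lemma hw_vec_borel (b : G) : borel b -> rep_act E b hw_vec \in <[hw_vec]>%VS.
Proof. by move=> bB; rewrite borel_hw_vec // memvZ // memv_line. Qed.

Lemma tcoord_hw_vec : tcoord hw_vec ord0 ord0 i1 = 1 /\ tcoord hw_vec i1 ord0 ord0 = 0.
Proof.
rewrite !tcoord_pure !eqxx i10 (eq_sym ord0) i10.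
by split; rewrite /= ?mulr0n ?mulr1n; ring.
Qed.

Lemma hw_vec_ker : hw_vec \in lker pi.
Proof.
by rewrite memv_ker wedge_mapE; apply/eqP/(@wedge_alt _ _ _ _ ord0 (inord 1));
  rewrite ?ffunE ?(tnth_nth (unit_vec i1)) /= ?inordK // -val_eqE /= inordK.
Qed.

Lemma hw_vec_img : hw_vec \notin limg iota.
Proof.
have [T1 T0] := tcoord_hw_vec.
apply/negP => /memv_imgP[y _ yE]; have := tcoef_iota_cyc (crd i1) (crd ord0) (crd ord0) y.
by rewrite -yE -!/(tcoord _ _ _ _) T1 T0 => /eqP; rewrite oner_eq0.
Qed.

(** This dichotomy holds in every characteristic; only the position of im iota
    relative to ker pi depends on p. *)
Lemma submodule_ker (W : subrep E) : ~~ (W <= limg iota)%VS -> (lker pi <= W)%VS.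
Proof.
move=> /subvPn[x xW xN].
have [xI|[a [b [c abc]]]] := cyc_or_not x; first by rewrite xI in xN.
exact/ker_pi_sub/(pure_mem n_ge6 xW abc).
Qed.

Lemma L_iso_of (N : rep K G) : is_L lambda12 N -> L_iso lambda12 N.
Proof. by move=> LN; split=> [|M LM]; [exists N | apply: is_L_unique LM LN]. Qed.

Lemma pi_iota y al be ga :
  tcoef al be ga (iota (pi (iota y))) = 3%:R * tcoef al be ga (iota y).
Proof.
by rewrite tcoef_iota_pi [tcoef be ga al _]tcoef_iota_cyc
  -[tcoef ga al be _]tcoef_iota_cyc; ring.
Qed.

Lemma img_iota_ker : 3%:R = 0 :> K -> (limg iota <= lker pi)%VS.
Proof.
move=> c3; apply/subvP => _ /memv_imgP[y _ ->]; rewrite memv_ker -memv0 -(iota_inj V).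
by rewrite memv_ker; apply/eqP/tcoef_eq0 => al be ga; rewrite pi_iota c3 mul0r.
Qed.

Lemma img_iota_cap_ker x : 3%:R != 0 :> K -> x \in limg iota -> x \in lker pi -> x = 0.
Proof.
move=> c3 /memv_imgP[y _ ->]; rewrite memv_ker => /eqP py.
apply/tcoef_eq0 => al be ga; apply/(mulfI c3).
by rewrite -pi_iota py linear0 tcoef0 mulr0.
Qed.

Lemma hw_vec_neq0 : hw_vec != 0.
Proof. by apply: contraNneq hw_vec_img => ->; apply: mem0v. Qed.

Lemma is_L_ker : 3%:R != 0 :> K -> is_L lambda12 (rker pi).
Proof.
move=> c3; split.
- exact/rational_sub/rational_tensor.
- apply: irreducible_sub => [|W Wker W0] /=.
    by apply: contraNneq hw_vec_neq0 => k0; rewrite -memv0 -k0 hw_vec_ker.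
  apply: submodule_ker; apply: contra W0 => /subvP WI; rewrite -subv0.
  apply/subvP => x xW; rewrite memv0; apply/eqP/(img_iota_cap_ker c3); first exact: WI.
  by move/subvP: Wker; apply.
- apply: (@highest_weight_sub _ _ _ (rker pi) lambda12 hw_vec).
  + exact: hw_vec_ker.
  + exact: hw_vec_neq0.
  + exact: hw_vec_weight.
  + exact: hw_vec_borel.
Qed.

Lemma is_L_ker_quot : is_L lambda12 (subquot (rker pi) (rimg iota)).
Proof.
split.
- exact/rational_quot/rational_sub/rational_tensor.
- apply: irreducible_subquot => [|W _] /=; last exact: submodule_ker.
  by apply: contra hw_vec_img => /subvP; apply; apply: hw_vec_ker.
- pose v : rker pi := Subvs hw_vec_ker.
  apply: (@highest_weight_quot _ _ _ _ lambda12 v).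
  + by rewrite mem_subrep_in hw_vec_img.
  + move=> t tT; apply: val_inj; apply: etrans (sub_actE _ _) _.
    by rewrite /= hw_vec_weight.
  + move=> b /hw_vec_borel/vlineP[a aE]; apply/vlineP; exists a; apply: val_inj.
    by apply: etrans (sub_actE _ _) _; rewrite /= aE.
Qed.

End KernelOfWedge.

Theorem mainTheorem4 (K : closedFieldType) (p l : nat)
    (p_char : p \in [pchar K]) (l_gt18 : (18 < l)%N) :
  let V := natural_rep K l.+1 in
  let lambda12 := fund_weight l.+1 1 + fund_weight l.+1 2 in
  let pi := wedge_map V in
  let iota := ext_embed V in
  (p != 3%N -> L_iso lambda12 (rker pi)) /\
  (p = 3%N ->
    [/\ lker iota = 0%VS,
        (limg iota <= lker pi)%VS
      & L_iso lambda12 (subquot (rker pi) (rimg iota))]).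
Proof.
move=> V lambda12 pi iota.
have n_ge6 : (6 <= l.+1)%N by lia.
have char3 : (3%:R == 0 :> K) = (p == 3%N).
  by rewrite -(dvdn_pcharf p_char) dvdn_prime2 ?(pcharf_prime p_char).
split=> [p3|p3].
  by apply: L_iso_of; apply: is_L_ker; rewrite ?char3.
split; first exact: iota_inj.
  by apply: img_iota_ker; apply/eqP; rewrite char3 p3.
exact/L_iso_of/is_L_ker_quot.
Qed.
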